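(* Let $T$ be a complete $\omega$-stable unimodular theory. Then $T$ is correspondence unimodular for types.
   Context: We work in a sufficiently saturated and ultrahomogeneous monster model of $T$, and in $T^{eq}$ (tuples are finite and may consist of imaginary elements; parameter sets are small). If $a$ is algebraic over $B$, $m(a/B)$ denotes the (finite) number of realizations of $\mathrm{tp}(a/B)$. Two tuples $a,b$ are interalgebraic over $A$ if $a\in\mathrm{acl}(Ab)$ and $b\in\mathrm{acl}(Aa)$. $T$ is unimodular if for any tuples $a,b$ and parameter set $A$ in the monster model, if $\mathrm{tp}(a/A)=\mathrm{tp}(b/A)$ and $a,b$ are interalgebraic over $A$, then $m(a/Ab)=m(b/Aa)$. A correspondence between type-definable sets $\pi,\pi'$ is a non-empty type-definable set $C(x,y)\vdash\pi(x)\times\pi'(y)$ such that all fibres $C_x=\{y\models\pi': C(x,y)\}$ ($x\models\pi$) and $C^y=\{x\models\pi: C(x,y)\}$ ($y\models\pi'$) are finite. It is uniform if $k_C=|C_x|$ and $\ell_C=|C^y|$ are constant, independent of $x\models\pi$ and $y\models\pi'$; its ratio is then $m_C=k_C/\ell_C$. $T$ is correspondence unimodular for types if for any two type-definable sets (partial types, over small parameter sets) $X,Y$ and any two uniform correspondences $C_1,C_2$ between $X$ and $Y$, one has $m_{C_1}=m_{C_2}$. *)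

(* Defs.v *)
From mathcomp Require Import all_boot all_order all_algebra.
From mathcomp Require Import boolp classical_sets functions cardinality.
Set Implicit Arguments. Unset Strict Implicit. Unset Printing Implicit Defensive.
Import GRing.Theory.
Local Open Scope classical_set_scope.
Local Open Scope card_scope.

Section Tuples.
Variable S : Type.

(* Typed de Bruijn variables of a context: the finite list of their sorts. *)
Inductive var : seq S -> S -> Type :=
| VZ s G : var (s :: G) s
| VS s G t : var G t -> var (s :: G) t.

Variable M : S -> Type.

Fixpoint tup (G : seq S) : Type :=
  if G is s :: G' then (M s * tup G')%type else unit.

Fixpoint tget G s (x : var G s) : tup G -> M s :=
  match x in var G s return tup G -> M s with
  | VZ _ _ => fun a => a.1
  | VS _ _ _ y => fun a => tget y a.2
  end.

Fixpoint ttab (G : seq S) : (forall s, var G s -> M s) -> tup G :=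
  match G return (forall s, var G s -> M s) -> tup G with
  | [::] => fun _ => tt
  | s :: G' => fun f => (f s (VZ s G'), ttab (fun t x => f t (VS s x)))
  end.

Fixpoint tcat (G D : seq S) : tup G -> tup D -> tup (G ++ D) :=
  match G return tup G -> tup D -> tup (G ++ D) with
  | [::] => fun _ b => b
  | s :: G' => fun a b => (a.1, tcat a.2 b)
  end.

(* Sets of elements, of possibly different sorts, are sets in {s & M s}. *)
Fixpoint rng (G : seq S) : tup G -> set {s & M s} :=
  match G return tup G -> set {s & M s} with
  | [::] => fun _ => set0
  | s :: G' => fun a => existT M s a.1 |` rng a.2
  end.

Fixpoint tmap (f : forall s, M s -> M s) (G : seq S) : tup G -> tup G :=
  match G return tup G -> tup G with
  | [::] => id
  | s :: G' => fun a => (f s a.1, tmap f a.2)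
  end.

End Tuples.

(* Many-sorted logic, as T^eq requires; one-sorted logic is [sort := unit]. *)
Record language := Language {
  sort : Type;
  fsym : Type;
  fdom : fsym -> seq sort;
  fcod : fsym -> sort;
  rsym : Type;
  rdom : rsym -> seq sort }.
Arguments fdom {l}.
Arguments fcod {l}.
Arguments rdom {l}.

Inductive term (L : language) (G : seq (sort L)) : sort L -> Type :=
| Var s : var G s -> term G s
| App (f : fsym L) : (forall s, var (fdom f) s -> term G s) -> term G (fcod f).

Inductive formula (L : language) (G : seq (sort L)) : Type :=
| Bot
| Eq s (t u : term G s)
| Rel (r : rsym L) (ts : forall s, var (rdom r) s -> term G s)
| Imp (phi psi : formula G)
| All s (phi : formula (s :: G)).
Arguments Bot {L G}.

Definition Neg L G (phi : @formula L G) : formula G := Imp phi Bot.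

Record structure (L : language) := Structure {
  carrier :> sort L -> Type;
  carrier_inh : forall s, inhabited (carrier s);
  fint : forall f : fsym L, tup carrier (fdom f) -> carrier (fcod f);
  rint : forall r : rsym L, set (tup carrier (rdom r)) }.

Fixpoint eval L (M : structure L) G s (t : term G s) (v : tup M G) : M s :=
  match t in term _ s return M s with
  | Var _ x => tget x v
  | App f ts => fint (ttab (fun s x => eval (ts s x) v))
  end.

Fixpoint sat L (M : structure L) G (phi : formula G) : set (tup M G) :=
  match phi with
  | Bot => fun _ => False
  | Eq _ t u => fun v => eval t v = eval u v
  | Rel r ts => fun v => rint (ttab (fun s x => eval (ts s x) v))
  | Imp p q => fun v => sat p v -> sat q v
  | All s p => fun v => forall c : M s, @sat L M (s :: G) p (c, v)
  end.

Definition sentence (L : language) := @formula L [::].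
Definition theory (L : language) := set (sentence L).

Definition model L (T : theory L) (M : structure L) : Prop :=
  forall phi, T phi -> sat (M := M) phi tt.

Definition entails L (T : theory L) (phi : sentence L) : Prop :=
  forall M, model T M -> sat (M := M) phi tt.

Definition complete L (T : theory L) : Prop :=
  (exists M, model T M) /\ forall phi, entails T phi \/ entails T (Neg phi).

(* A formula with parameters: free variables in [G], the others instantiated. *)
Record pformula L (M : structure L) (G : seq (sort L)) := PFormula {
  pctx : seq (sort L);
  pform : formula (G ++ pctx);
  ppar : tup M pctx }.

Section Types.
Variables (L : language) (M : structure L).
Implicit Types (G D : seq (sort L)) (A B : set {s & M s}).

Definition psat G (phi : pformula M G) : set (tup M G) :=
  [set a | sat (pform phi) (tcat a (ppar phi))].

Definition pNeg G (phi : pformula M G) : pformula M G :=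
  PFormula (Neg (pform phi)) (ppar phi).

Definition over A G : set (pformula M G) := [set phi | rng (ppar phi) `<=` A].

Definition fin_sat G (p : set (pformula M G)) : Prop :=
  forall F : set (pformula M G), finite_set F -> F `<=` p ->
    exists a, forall phi, F phi -> psat phi a.

Definition types A G : set (set (pformula M G)) :=
  [set p | [/\ p `<=` over A (G := G), fin_sat p
             & forall phi, over A phi -> p phi \/ p (pNeg phi)]].

Definition real G (p : set (pformula M G)) : set (tup M G) :=
  [set a | forall phi, p phi -> psat phi a].

Definition tp G (a : tup M G) A : set (pformula M G) :=
  [set phi | over A phi /\ psat phi a].

Definition acl A : set {s & M s} :=
  [set c | exists phi : pformula M [:: projT1 c],
    [/\ over A phi, psat phi (projT2 c, tt) & finite_set (psat phi)]].

Definition interalg G D (a : tup M G) (b : tup M D) A : Prop :=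
  rng a `<=` acl (A `|` rng b) /\ rng b `<=` acl (A `|` rng a).

End Types.
Arguments over {L M} A {G}.
Arguments types {L M} A G.

(* The number of elements of a finite set (0 on infinite sets). *)
Definition ncard T (A : set T) : nat := xget 0%N [set n | A #= `I_n].

Definition mult L (M : structure L) G (a : tup M G) (B : set {s & M s}) : nat :=
  ncard (real (tp a B)).

Definition omega_stable L (T : theory L) : Prop :=
  forall (M : structure L) (A : set {s & M s}) (G : seq (sort L)),
    model T M -> countable A -> countable (types A G).

(* A cardinal kappa is given by a type [K] of that cardinality. *)
Definition card_lt T (A : set T) (K : Type) : Prop := ~ ([set: K] #<= A).

Section Monster.
Variables (L : language) (K : Type) (M : structure L).

Definition saturated : Prop :=
  forall (A : set {s & M s}) G (p : set (pformula M G)),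
    card_lt A K -> types A G p -> real p !=set0.

Definition automorphism (g : forall s, M s -> M s) : Prop :=
  [/\ forall s, bijective (g s),
      forall f (a : tup M (fdom f)), fint (tmap g a) = g _ (fint a)
    & forall r (a : tup M (rdom r)), rint (tmap g a) <-> rint a].

(* Only the restriction of [f] to [A] matters. *)
Definition partial_elementary (A : set {s & M s}) (f : forall s, M s -> M s) :=
  forall G (phi : formula G) (a : tup M G), rng a `<=` A ->
    (sat phi a <-> sat phi (tmap f a)).

Definition strongly_homogeneous : Prop :=
  forall (A : set {s & M s}) (f : forall s, M s -> M s),
    card_lt A K -> partial_elementary A f ->
    exists g, automorphism g /\
      forall s (c : M s), A (existT M s c) -> g s c = f s c.

End Monster.

Record monster L (T : theory L) (K : Type) (U : structure L) : Prop := {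
  monster_model : model T U;
  (* kappa > |L| + aleph_0, as the set of L-formulas is always infinite *)
  monster_large : card_lt [set: {G & @formula L G}] K;
  monster_saturated : saturated K U;
  monster_homogeneous : strongly_homogeneous K U }.

Section Eq.
Variables (L : language) (M : structure L).

Definition equivalence T (R : T -> T -> Prop) : Prop :=
  [/\ forall x, R x x, forall x y, R x y -> R y x
    & forall x y z, R x y -> R y z -> R x z].

(* The 0-definable equivalence relations on finite products of sorts. *)
Record eqform := EqForm {
  ectx : seq (sort L);
  eform : formula (ectx ++ ectx);
  eformP : equivalence (fun x y : tup M ectx => sat eform (tcat x y)) }.

Definition eclass (E : eqform) (x : tup M (ectx E)) : set (tup M (ectx E)) :=
  [set y | sat (eform E) (tcat x y)].

Definition equot (E : eqform) : Type :=
  {C : set (tup M (ectx E)) | exists x, C = eclass x}.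

Definition eproj (E : eqform) (x : tup M (ectx E)) : equot E :=
  exist _ (eclass x) (ex_intro _ x erefl).

(* One new sort, and one new function symbol x |-> x/E, for each E. *)
Definition eq_lang : language := {|
  sort := sort L + eqform;
  fsym := fsym L + eqform;
  fdom := fun f => match f with
                   | inl f => map inl (fdom f) | inr E => map inl (ectx E) end;
  fcod := fun f => match f with inl f => inl (fcod f) | inr E => inr E end;
  rsym := rsym L;
  rdom := fun r => map inl (rdom r) |}.

Definition eq_carrier (s : sort eq_lang) : Type :=
  match s with inl s => M s | inr E => equot E end.

Fixpoint home (G : seq (sort L)) : tup eq_carrier (map inl G) -> tup M G :=
  match G return tup eq_carrier (map inl G) -> tup M G with
  | [::] => id
  | s :: G' => fun a => (a.1, home a.2)
  end.

Fact tup_inh (G : seq (sort L)) : inhabited (tup M G).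
Proof.
elim: G => [|s G [a]] /=; first exact: (inhabits tt).
by case: (carrier_inh M s) => c; exact: (inhabits (c, a)).
Qed.

Fact eq_carrier_inh (s : sort eq_lang) : inhabited (eq_carrier s).
Proof.
case: s => [s|E]; first exact: carrier_inh.
by case: (tup_inh (ectx E)) => a; exact: (inhabits (eproj a)).
Qed.

Definition eq_struct : structure eq_lang := {|
  carrier := eq_carrier;
  carrier_inh := eq_carrier_inh;
  fint := fun f =>
    match f return tup eq_carrier (@fdom eq_lang f) ->
                   eq_carrier (@fcod eq_lang f) with
    | inl f => fun a => fint (home a)
    | inr E => fun a => eproj (home a)
    end;
  rint := fun r a => @rint L M r (home a) |}.

End Eq.

Definition unimodular L (K : Type) (U : structure L) : Prop :=
  forall (G : seq (sort (eq_lang U))) (a b : tup (eq_struct U) G)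
         (A : set {s & eq_struct U s}),
    card_lt A K -> tp a A = tp b A -> interalg a b A ->
    mult a (A `|` rng b) = mult b (A `|` rng a).

Section Correspondences.
Variables (L : language) (K : Type) (N : structure L).

Definition type_definable G (X : set (tup N G)) : Prop :=
  exists (A : set {s & N s}) (p : set (pformula N G)),
    [/\ card_lt A K, p `<=` over A (G := G) & X = real p].

Section Between.
Variables (G D : seq (sort L)) (X : set (tup N G)) (Y : set (tup N D)).
Variable C : set (tup N (G ++ D)).

Definition rfibre (x : tup N G) : set (tup N D) :=
  [set y | Y y /\ C (tcat x y)].

Definition lfibre (y : tup N D) : set (tup N G) :=
  [set x | X x /\ C (tcat x y)].

Record correspondence : Prop := {
  corr_def : type_definable C;
  corr_nonempty : C !=set0;
  corr_sub : forall x y, C (tcat x y) -> X x /\ Y y;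
  corr_rfin : forall x, X x -> finite_set (rfibre x);
  corr_lfin : forall y, Y y -> finite_set (lfibre y) }.

Record uniform_correspondence (k l : nat) : Prop := {
  ucorr_corr : correspondence;
  ucorr_r : forall x, X x -> rfibre x #= `I_k;
  ucorr_l : forall y, Y y -> lfibre y #= `I_l }.

End Between.
End Correspondences.

(* Here k1, l1, k2, l2 > 0, because correspondences are non-empty. *)
Definition corr_unimodular L (K : Type) (U : structure L) : Prop :=
  forall (G D : seq (sort (eq_lang U)))
         (X : set (tup (eq_struct U) G)) (Y : set (tup (eq_struct U) D))
         (C1 C2 : set (tup (eq_struct U) (G ++ D))) (k1 l1 k2 l2 : nat),
    type_definable K X -> type_definable K Y ->
    uniform_correspondence K X Y C1 k1 l1 ->
    uniform_correspondence K X Y C2 k2 l2 ->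
    (k1%:R / l1%:R = k2%:R / l2%:R :> rat)%R.

(* Main.v *)
(* By omega-stability, every non-empty closed set of types over a small set
   [A] has an isolated point (else one builds a binary tree of definable
   sets, which has uncountably many branches but countably many parameters).
   Take a minimal non-empty closed [E] inside [X] that is stable under going
   from [X] to [Y] and back along the two correspondences. Uniformity of a
   correspondence makes its projections to [X] and [Y] open, so isolation of
   a type propagates along both correspondences; by minimality every type of
   [E] is isolated, and by compactness [E] consists of finitely many
   complete types over [A]. Put [ratio a b = m(b/Aa) / m(a/Ab)] for
   interalgebraic [a], [b]. It is multiplicative, and unimodularity makes it
   depend on the types of [a] and [b] over [A] only. Weighting the finitely
   many types by their ratio to a base point [o] and double counting the
   pairs of a correspondence gives [k * sum of weights on X = l * sum of
   weights on Y], where the two sums do not depend on the correspondence. *)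
From mathcomp Require Import all_boot all_order all_algebra.
From mathcomp Require Import boolp classical_sets functions cardinality filter ring.
Require Import Defs.
Set Implicit Arguments. Unset Strict Implicit. Unset Printing Implicit Defensive.
Import Order.TTheory GRing.Theory Num.Theory.
Local Open Scope classical_set_scope.
Local Open Scope card_scope.

(** * Cardinals and counting *)

(** [X] may carry infinitely many types over [A], so a total weight of [X] need not make sense;
    hence the search for a finite piece that both correspondences respect. Minimality bites because
    the non-isolated points of [E] again form a closed stable subset, which misses some isolated
    point and so must be empty. The weight of a type is [ratio o x'] at a realization [x']
    interalgebraic with [o]; the count is done on the types that have such a realization. That
    ratios depend on types alone comes from moving one of the two tuples: its two positions have the
    same type and are interalgebraic, so unimodularity gives them ratio 1. Correspondences live in
    [eq_struct U], while saturation and omega-stability speak of [U]; both are turned into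
    statements on definable sets (compactness, absence of binary trees), which pass to imaginaries
    by pulling back along the quotient maps. *)

Lemma rel_card_le T U (A : set T) (B : set U) (r : T -> U -> Prop) :
  (forall x, A x -> exists2 y, B y & r x y) ->
  (forall x x' y, A x -> A x' -> B y -> r x y -> r x' y -> x = x') -> A #<= B.
Proof.
move=> tot inj; have [->|] := eqVneq A set0; first exact: card_ge0.
move=> /set0P[x0 Ax0]; have [y0 _ _] := tot _ Ax0.
have [f fP] : {f : T -> U & forall x, A x -> B (f x) /\ r x (f x)}.
  apply: (@choice _ _ (fun x y => A x -> B y /\ r x y)) => x.
  have [Ax|nAx] := pselect (A x); last by exists y0.
  by have [y By rxy] := tot _ Ax; exists y.
have [g] : $|{injfun A >-> B}|; last exact: inj_card_le.
apply/injfunPex; exists f; first by move=> x /fP[].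
move=> x x' /set_mem Ax /set_mem Ax' e.
by apply: (inj _ _ (f x) Ax Ax' _ _ _); [case: (fP _ Ax)|case: (fP _ Ax)|rewrite e; case: (fP _ Ax')].
Qed.

Lemma card_leEinj T U (A : set T) (B : set U) : A #<= B -> A !=set0 ->
  exists2 f : T -> U, (forall x, A x -> B (f x)) &
    forall x y, A x -> A y -> f x = f y -> x = y.
Proof.
move=> /card_leP[g] [x0 Ax0].
have y0 : U by exact: (set_val (g (SigSub (mem_set Ax0)))).
exists (fun x => if pselect (A x) is left Ax then
                  set_val (g (SigSub (mem_set Ax))) else y0).
  by move=> x Ax; case: pselect => // Ax'; apply: set_mem; exact: valP.
move=> x y Ax Ay; case: pselect => // Ax'; case: pselect => // Ay'.
move=> /val_inj /inj e; have := e (mem_set I) (mem_set I).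
by move=> /(congr1 val).
Qed.

(** Zorn's lemma on partial injections from [A] to [B]: a maximal one is defined on all of [A] or
    reaches all of [B], else one more pair could be added. *)
Lemma card_le_total T U (A : set T) (B : set U) : A #<= B \/ B #<= A.
Proof.
pose P (r : set (T * U)) := (forall z, r z -> A z.1 /\ B z.2) /\
  (forall z z', r z -> r z' -> z.1 = z'.1 <-> z.2 = z'.2).
have [|r [[rAB rinj] rmax]] := @Zorn_bigcup _ P.
  move=> F FP Ftot; split; first by move=> z [r Fr rz]; have [/(_ _ rz)] := FP _ Fr.
  move=> z z' [r Fr rz] [r' Fr' rz'].
  by have [s|s] := Ftot _ _ Fr Fr'; [have [_]:= FP _ Fr'|have [_]:= FP _ Fr]; apply=> //; apply: s.
have [tot|/existsNP[x /not_implyP[Ax nx]]] :=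
    pselect (forall x, A x -> exists y, r (x, y)).
  left; apply: (@rel_card_le _ _ _ _ (fun x y => r (x, y))).
    by move=> x /tot[y rxy]; exists y => //; have [] := rAB _ rxy.
  by move=> x x' y _ _ _ rxy rx'y; apply/(rinj _ _ rxy rx'y).
right; apply: (@rel_card_le _ _ _ _ (fun y x => r (x, y))); last first.
  by move=> y y' x0 _ _ _ rxy rxy'; apply/(rinj _ _ rxy rxy').
move=> y By; apply: contrapT => ny.
apply: (rmax (r `|` [set (x, y)])).
  split; first by left.
  by move=> /(_ (x, y) (or_intror erefl)) rxy; apply: nx; exists y.
have ny' x' : ~ r (x', y).
  by move=> h; apply: ny; exists x' => //; have [] := rAB _ h.
split=> [z [/rAB//|->//]|[x1 y1] [x2 y2] [r1|[-> ->]] [r2|[-> ->]]] //=.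
- exact: (rinj _ _ r1 r2).
- by split=> e; subst; [case: nx; exists y1|case: (ny' x1)].
- by split=> e; subst; [case: nx; exists y2|case: (ny' x2)].
Qed.

(* A maximal disjoint family of sequences in [A] misses finitely many points,
   and each sequence absorbs the factor [nat]. *)
Lemma card_le_setX_nat T (A : set T) : infinite_set A ->
  A `*` [set: nat] #<= A.
Proof.
move=> Ainf.
pose D := [set f : nat -> T | injective f /\ range f `<=` A].
have [E [ED Etriv Emax]] := ex_maximal_disjoint_subcollection (fun f : nat -> T => range f) D.
have seqD B : infinite_set B -> B `<=` A -> exists2 f, D f & range f `<=` B.
  move=> /infiniteP/card_leEinj-/(_ (ex_intro _ 0%N I))[f fB finj] BA.
  exists f; last by move=> _ [n _ <-]; apply: fB.
  by split=> [n m|_ [n _ <-]]; [apply: finj|apply: BA; apply: fB].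
pose Z := \bigcup_(f in E) range f.
have Zfin : finite_set (A `\` Z).
  apply: contrapT => /seqD[x []//|f Df fZ].
  apply: (Emax (f |` E)).
  - split; first by right.
    move=> sub; have : E f by apply: sub; left.
    move=> Ef; have [] := fZ (f 0%N); first by exists 0%N.
    by move=> _; apply; exists f => //; exists 0%N.
  - by move=> g [->//|/ED].
  - have disj g x : E g -> range f x -> range g x -> False.
      by move=> Eg /fZ[_ nZ] gx; apply: nZ; exists g.
    move=> g h [->|Eg] [->|Eh] [x []]//; last by move=> gx hx; apply: Etriv => //; exists x.
    + by move=> /(disj _ _ Eh) h1 /h1.
    + by move=> gx /(disj _ _ Eg) /(_ gx).
have [f0 Ef0] : E !=set0.
  apply/set0P/eqP => E0; apply: Ainf.
  by move: Zfin; rewrite /Z E0 bigcup_set0 setD0.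
have [c cinj] : exists c : T -> nat, forall x y, (A `\` Z) x -> (A `\` Z) y -> c x = c y -> x = y.
  have [->|/set0P ne] := eqVneq (A `\` Z) set0; first by exists (fun=> 0%N).
  by have [c _ cP] := card_leEinj (finite_set_countable Zfin) ne; exists c.
(* A point of a sequence [f] stays in the range of [f]; the finitely many points outside are
   numbered by [c] and sent into [f0]. The tags 0 and 1 keep the two kinds apart there. *)
pose code (w : T * nat) (y : T) :=
  (exists f i, [/\ E f, w.1 = f i & y = f (pickle (0%N, i, w.2))]) \/
  (~ Z w.1 /\ y = f0 (pickle (1%N, c w.1, w.2))).
apply: (@rel_card_le _ _ _ _ code).
  move=> [x n] [/= Ax _]; have [[f Ef [i _ fi]]|nZ] := pselect (Z x).
    exists (f (pickle (0%N, i, n))); first by have [_] := ED _ Ef; apply; eexists.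
    by left; exists f, i.
  exists (f0 (pickle (1%N, c x, n))); first by have [_] := ED _ Ef0; apply; eexists.
  by right.
have same f g i j : E f -> E g -> f i = g j -> f = g /\ i = j.
  move=> Ef Eg e; have fg : f = g.
    by apply: Etriv => //; exists (f i); split; [exists i|exists j].
  by subst; split=> //; have [/(_ _ _ e)] := ED _ Eg.
have pinj (a b : nat * nat * nat) : pickle a = pickle b -> a = b.
  exact: (pcan_inj pickleK).
move=> [x n] [x' n'] y [/= Ax _] [/= Ax' _] _.
move=> [[f [i [Ef /= -> ->]]]|[/= nZ ->]] [[g [j [Eg /= -> e]]]|[/= nZ' e]].
- by have [-> /pinj[-> ->]] := same _ _ _ _ Ef Eg e.
- by have [_ /pinj] := same _ _ _ _ Ef Ef0 e.
- by have [_ /pinj] := same _ _ _ _ Ef0 Eg e.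
- by have [_ /pinj[/cinj ->// ->]] := same _ _ _ _ Ef0 Ef0 e.
Qed.

Section Small.
Variable K : Type.
Hypothesis Kunc : ~ countable [set: K].

Lemma card_lt_countable T (A : set T) : countable A -> card_lt A K.
Proof. by move=> cA KA; apply: Kunc; exact: card_le_trans KA cA. Qed.

Lemma card_lt_le T U (A : set T) (B : set U) : A #<= B -> card_lt B K -> card_lt A K.
Proof. by move=> AB nB KA; apply: nB; exact: card_le_trans KA AB. Qed.

(** The union embeds into [A] times [nat], a factor that an infinite [A] absorbs; for finite [A] the
    union is countable, hence small. *)
Lemma card_lt_bigcup I T (A : set I) (F : I -> set T) :
  (forall i, A i -> countable (F i)) -> card_lt A K ->
  card_lt (\bigcup_(i in A) F i) K.
Proof.
move=> Fc Alt; have [Afin|Ainf] := pselect (finite_set A).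
  apply: card_lt_countable; apply: bigcup_countable => //.
  exact: finite_set_countable.
apply: card_lt_le Alt; apply: card_le_trans (card_le_setX_nat Ainf).
have [e eP] : {e : I -> T -> nat & forall i, A i -> forall x y, F i x -> F i y -> e i x = e i y -> x = y}.
  apply: (@choice _ _ (fun i (e : T -> nat) => A i -> forall x y, F i x -> F i y -> e x = e y -> x = y)) => i.
  have [Ai|nAi] := pselect (A i); last by exists (fun=> 0%N).
  have [->|/set0P ne] := eqVneq (F i) set0; first by exists (fun=> 0%N).
  by have [e _ eP] := card_leEinj (Fc _ Ai) ne; exists e.
apply: (@rel_card_le _ _ _ _ (fun x w => F w.1 x /\ e w.1 x = w.2)).
  by move=> x [i Ai Fx]; exists (i, e i x).
by move=> x x' [i n] _ _ [/= Ai _] [Fx <-] [Fx' e']; apply: (eP _ Ai).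
Qed.

(** Once [A] is injected into [B] by [f], the union is indexed by [B]: each [y] contributes itself
    and its preimage under [f], at most two points. *)
Lemma card_ltU T (A B : set T) : card_lt A K -> card_lt B K -> card_lt (A `|` B) K.
Proof.
wlog : A B / A #<= B.
  move=> H Alt Blt; have [AB|BA] := card_le_total A B; first exact: H.
  by rewrite setUC; exact: H.
have [->|/set0P Ane] := eqVneq A set0; first by rewrite set0U.
move=> /card_leEinj-/(_ Ane)[f fB finj] _ Blt.
apply: (@card_lt_le _ _ _ (\bigcup_(y in B) (y |` [set x | A x /\ f x = y]))).
  apply: subset_card_le => x [Ax|Bx]; last by exists x => //; left.
  by exists (f x); [exact: fB|right].
apply: card_lt_bigcup Blt => y _; apply: finite_set_countable.
rewrite finite_setU; split=> //.
have [[x [Ax fx]]|no] := pselect (exists x, A x /\ f x = y).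
  apply: sub_finite_set (finite_set1 x) => x' [Ax' fx'].
  by apply: finj => //; rewrite fx.
by apply: sub_finite_set (@finite_set0 T) => x h; case: no; exists x.
Qed.

End Small.

Section Counting.
Implicit Types T U : Type.

Lemma card_ncard T (A : set T) n : A #= `I_n -> ncard A = n.
Proof.
move=> An; apply: xget_unique => // m Am.
by apply/card_eq_II; rewrite card_eq_sym; apply: card_eq_trans Am; rewrite card_eq_sym.
Qed.

Lemma finite_ncard T (A : set T) : finite_set A -> A #= `I_(ncard A).
Proof. by move=> /finite_setP[n An]; rewrite (card_ncard An). Qed.

Lemma eq_ncard T U (A : set T) (B : set U) : A #= B -> finite_set B -> ncard A = ncard B.
Proof. by move=> AB /finite_ncard Bn; apply: card_ncard; apply: card_eq_trans AB Bn. Qed.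

Lemma ncard0 T : ncard (@set0 T) = 0%N.
Proof. by apply: card_ncard; rewrite II0; exact: card_eq00. Qed.

Lemma ncardD1 T (A : set T) x : finite_set A -> A x -> ncard A = (ncard (A `\ x)).+1.
Proof.
move=> Afin Ax; apply: card_ncard; apply/eq_cardSP; exists x => //.
by apply: finite_ncard; exact: finite_setD.
Qed.

Lemma finite_ind T (P : set T -> Prop) : P set0 ->
  (forall A x, finite_set A -> A x -> P (A `\ x) -> P A) ->
  forall A, finite_set A -> P A.
Proof.
move=> P0 PS A Afin; move nE : (ncard A) => n; elim: n A Afin nE => [|n IH] A Afin An.
  have [->//|/set0P[x Ax]] := eqVneq A set0.
  by move: An; rewrite (ncardD1 Afin Ax).
have [A0|/set0P[x Ax]] := eqVneq A set0; first by move: An; rewrite A0 ncard0.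
apply: (PS _ x) => //; apply: IH; first exact: finite_setD.
by move: An; rewrite (ncardD1 Afin Ax) => -[].
Qed.

Lemma ncard_gt0 T (A : set T) : finite_set A -> A !=set0 -> (0 < ncard A)%N.
Proof. by move=> Afin [x Ax]; rewrite (ncardD1 Afin Ax). Qed.

Lemma ncardU T (A B : set T) : finite_set A -> finite_set B ->
  (forall x, A x -> B x -> False) -> ncard (A `|` B) = (ncard A + ncard B)%N.
Proof.
move=> Afin Bfin; elim/finite_ind: A / Afin => [|A x Afin Ax IH] AB.
  by rewrite set0U ncard0.
rewrite (@ncardD1 _ (A `|` B) x); last by left.
  rewrite (ncardD1 Afin Ax) addSn -IH; last by move=> y [Ay _] /(AB _ Ay).
  congr (ncard _).+1; apply/seteqP; split=> y.
    by move=> [[Ay|By] yx]; [left|right].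
  move=> [[Ay yx]|By]; split=> //; [by left|by right|].
  by move=> /= yx; apply: (AB x) => //; rewrite -yx.
by rewrite finite_setU.
Qed.

Lemma ncard_sub T (A B : set T) : finite_set B -> A `<=` B ->
  ncard B = (ncard A + ncard (B `\` A))%N.
Proof.
move=> Bfin AB; rewrite -ncardU; first by rewrite setDUK.
- exact: sub_finite_set Bfin.
- exact: finite_setD.
- by move=> x Ax [].
Qed.

Lemma ncardX T U (A : set T) (B : T -> set U) n : finite_set A ->
  (forall x, A x -> finite_set (B x) /\ ncard (B x) = n) ->
  finite_set (A `*`` B) /\ ncard (A `*`` B) = (ncard A * n)%N.
Proof.
move=> Afin; elim/finite_ind: A / Afin => [|A x Afin Ax IH] AB.
  have -> : set0 `*`` B = set0 by apply/seteqP; split=> // -[? ?] [].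
  by rewrite !ncard0.
have [IHf IHn] := IH (fun y Ay => AB y Ay.1).
have [Bf Bn] := AB _ Ax.
have e : A `*`` B = [set (x, y) | y in B x] `|` ((A `\ x) `*`` B).
  apply/seteqP; split=> -[u v] /=.
    move=> [Au Bv]; have [xu|xu] := pselect (x = u); first by left; exists v; rewrite ?xu.
    by right; split=> //; split=> // /esym.
  by case=> [[w Bw [<- <-]]|[[Au _] Bv]].
have im : [set (x, y) | y in B x] #= B x by apply: inj_card_eq => y y' _ _ [].
have imf : finite_set [set (x, y) | y in B x] by exact: finite_image.
rewrite e finite_setU; split=> //.
rewrite ncardU//; last by move=> _ [y _ <-] [[_ h] _]; apply: h.
by rewrite IHn (eq_ncard im)// Bn (ncardD1 Afin Ax) mulSn.
Qed.

(** The first disjunct is there because [ncard] is 0 on infinite sets. The recursion [atleastS]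
    picks one witness at a time and can thus be followed by first-order formulas. *)
Definition atleast n T (A : set T) := infinite_set A \/ (n <= ncard A)%N.

Lemma atleastS n T (A : set T) :
  atleast n.+1 A <-> exists2 x, A x & atleast n (A `\ x).
Proof.
have [Afin|Ainf] := pselect (finite_set A).
  split=> [[]//|[x Ax [|nA]]].
  - move=> nA; have [A0|/set0P[x Ax]] := eqVneq A set0; first by move: nA; rewrite A0 ncard0.
    by exists x => //; right; move: nA; rewrite (ncardD1 Afin Ax).
  - by case; exact: finite_setD.
  - by right; rewrite (ncardD1 Afin Ax).
split=> _; last by left.
have [x Ax] := infinite_setN0 Ainf; exists x => //; left => fin; apply: Ainf.
by rewrite -(setD1K Ax) finite_setU; split.
Qed.

Lemma atleast_finite T (A : set T) n : ~ atleast n A -> finite_set A /\ (ncard A < n)%N.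
Proof. by move=> /not_orP[/contrapT ? /negP]; rewrite -ltnNge. Qed.

Lemma finite_atleast T U (A : set T) (B : set U) :
  (forall n, atleast n A -> atleast n B) -> finite_set B ->
  finite_set A /\ (ncard A <= ncard B)%N.
Proof.
move=> AB Bfin.
have : ~ atleast (ncard B).+1 A by move=> /AB[//|]; rewrite ltnn.
by move=> /atleast_finite[].
Qed.

Definition distinct T (E : T -> T -> Prop) (s : seq T) :=
  pairwise (fun x y => `[< ~ E x y >]) s.

Lemma ncard_classes T (E : T -> T -> Prop) (A : set T) s :
  (forall x y z, E x z -> E y z -> E x y) ->
  distinct E s -> finite_set A -> (forall x, A x -> has (fun y => `[< E y x >]) s) ->
  ncard A = (\sum_(y <- s) ncard (A `&` E y))%N.
Proof.
move=> Eeq; elim: s A => [|y s IH] A /=.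
  move=> _ _ cov; rewrite big_nil; suff -> : A = set0 by exact: ncard0.
  by apply/seteqP; split=> // x /cov.
move=> /andP[ys sd] Afin cov; rewrite big_cons.
rewrite (@ncard_sub _ (A `&` E y) A)//; congr addn.
rewrite (IH (A `\` (A `&` E y)))//; first last.
- move=> x [Ax nx]; have /orP[/asboolP yx|//] := cov _ Ax.
  by case: nx.
- exact: finite_setD.
elim: s ys {IH sd cov} => [|z s IH] /=; first by rewrite !big_nil.
move=> /andP[/asboolP yz ys]; rewrite !big_cons IH//; congr addn; congr ncard.
apply/seteqP; split=> x; first by move=> [[? _] ?].
by move=> [Ax zx]; split=> //; split=> // -[_ yx]; apply: yz; exact: Eeq yx zx.
Qed.

(** Members of [s] may lie outside [S]. Each is dropped if its class misses [S], and otherwise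
    replaced by some [z] of [S] in its class, after which the rest of [s] has to cover only [S]
    minus that class. *)
Lemma distinct_reps T (E : T -> T -> Prop) (S : set T) s :
  (forall x, E x x) -> (forall x y, E x y -> E y x) ->
  (forall x y z, E x y -> E y z -> E x z) ->
  (forall x, S x -> has (fun y => `[< E y x >]) s) ->
  exists t, [/\ distinct E t, forall x, S x -> has (fun y => `[< E y x >]) t
    & all (fun y => `[< S y >]) t].
Proof.
move=> Er Es Et; elim: s S => [|y s IH] S cov.
  by exists [::]; split.
have [[z [Sz yz]]|no] := pselect (exists z, S z /\ E y z); last first.
  apply: IH => x Sx; have /= /orP[/asboolP yx|//] := cov _ Sx.
  by case: no; exists x.
have [|t [td tcov tS]] := IH (S `\` E z).
  move=> x [Sx zx]; have /= /orP[/asboolP yx|//] := cov _ Sx.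
  by case: zx; apply: Et yx; exact: Es.
exists (z :: t); split=> /=.
- rewrite /distinct/= [X in _ && X]td andbT; apply: sub_all tS => x /asboolP[_ zx].
  exact/asboolP.
- move=> x Sx; have [zx|zx] := pselect (E z x); first by rewrite asboolT.
  by rewrite tcov ?orbT.
- by rewrite asboolT//=; apply: sub_all tS => x /asboolP[Sx _]; exact/asboolP.
Qed.

End Counting.

(** * Definable sets *)

Section TupleTheory.
Variables (S : Type) (M : S -> Type).
Implicit Types G D : seq S.

Fixpoint tl G D : tup M (G ++ D) -> tup M G :=
  match G return tup M (G ++ D) -> tup M G with
  | [::] => fun _ => tt
  | s :: G' => fun a => (a.1, tl a.2)
  end.

Fixpoint tr G D : tup M (G ++ D) -> tup M D :=
  match G return tup M (G ++ D) -> tup M D with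
  | [::] => id
  | s :: G' => fun a => tr a.2
  end.

Lemma tl_tcat G D (a : tup M G) (b : tup M D) : tl (tcat a b) = a.
Proof. by elim: G a => [[]|s G IH [x a]] //=; rewrite IH. Qed.

Lemma tr_tcat G D (a : tup M G) (b : tup M D) : tr (tcat a b) = b.
Proof. by elim: G a => [|s G IH [x a]] //=. Qed.

Lemma tcat_tl_tr G D (w : tup M (G ++ D)) : tcat (tl w) (tr w) = w.
Proof. elim: G w => [|s G IH] w //=. rewrite IH. by case: w. Qed.

Lemma tcatP G D (w : tup M (G ++ D)) : exists a b, w = tcat a b.
Proof. by exists (tl w), (tr w); rewrite tcat_tl_tr. Qed.

Lemma tget_ttab G s (x : var G s) (f : forall s, var G s -> M s) :
  tget x (ttab f) = f s x.
Proof. by elim: x f => //= *; auto. Qed.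

(** Dependent inversion by a match on the context, so that an equation remains between sorts but
    none between contexts. *)
Lemma var_inv G t (x : var G t) :
  match G return var G t -> Prop with
  | [::] => fun _ => False
  | s :: G' => fun x => (exists e : s = t, x = ecast t (var (s :: G') t) e (VZ s G')) \/
                        exists y : var G' t, x = VS s y
  end x.
Proof. by case: x => [s G'|s G' t' y]; [left; exists erefl|right; exists y]. Qed.

Lemma tupP G (a b : tup M G) : (forall s (x : var G s), tget x a = tget x b) -> a = b.
Proof.
elim: G a b => [[] []|s G IH [x a] [y b]] // e.
have /= -> := e _ (VZ s G); rewrite (IH a b)// => t z.
exact: (e _ (VS s z)).
Qed.

Lemma rngP G (a : tup M G) c :
  rng a c <-> exists s (x : var G s), c = existT M s (tget x a).
Proof.
elim: G a c => [|s G IH] a c /=; first by split=> // -[s [x _]]; case: (var_inv x).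
split=> [[->|/IH[t [x ->]]]|[t [x ->]]].
- by exists s, (VZ s G).
- by exists t, (VS s x).
- have [[e ->]|[y ->]] := var_inv x; first by left; case: t / e {x}.
  by right; apply/IH; exists t, y.
Qed.

Lemma rng_tget G (a : tup M G) c : rng a c ->
  exists x : var G (projT1 c), tget x a = projT2 c.
Proof. by move=> /rngP[s [x ->]]; exists x. Qed.

Lemma rng_tcat G D (a : tup M G) (b : tup M D) : rng (tcat a b) = rng a `|` rng b.
Proof. by elim: G a => [|s G IH] a /=; rewrite ?set0U// IH setUA. Qed.

Lemma finite_rng G (a : tup M G) : finite_set (rng a).
Proof. by elim: G a => [|s G IH] a //=; rewrite finite_setU. Qed.

End TupleTheory.

Section Definability.
Variables (L : language) (M : structure L).
Implicit Types (G D P : seq (sort L)) (A B : set {s & M s}).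

(** Substitution seen semantically: renaming of variables and insertion of terms are such maps, and
    [zdef_preim] is the substitution lemma. *)
Definition termmap G D (f : tup M G -> tup M D) :=
  forall s (x : var D s), exists t : term G s, forall v, eval t v = tget x (f v).

Lemma eval_termmap G D (f : tup M G -> tup M D) s (t : term D s) : termmap f ->
  exists t' : term G s, forall v, eval t' v = eval t (f v).
Proof.
move=> ft; elim: t => {s} [s x|h ts IH]; first exact: ft.
pose us s x := sval (cid (IH s x)).
have usP s x v : eval (us s x) v = eval (ts s x) (f v) by rewrite /us; case: cid.
exists (App us) => v /=; congr fint; apply: tupP => s x.
by rewrite !tget_ttab usP.
Qed.

Lemma termmap_id G : termmap (@id (tup M G)).
Proof. by move=> s x; exists (Var x). Qed.

Lemma termmap_comp G D P (f : tup M G -> tup M D) (g : tup M D -> tup M P) :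
  termmap f -> termmap g -> termmap (g \o f).
Proof.
move=> ft gt s x; have [t tP] := gt _ x.
by have [t' t'P] := eval_termmap t ft; exists t' => v; rewrite t'P tP.
Qed.

Lemma termmap_tail s G : termmap (fun a : tup M (s :: G) => a.2 : tup M G).
Proof. by move=> t x; exists (Var (VS s x)). Qed.

Lemma termmap_cons s G D (h : tup M G -> M s) (f : tup M G -> tup M D) :
  (exists t : term G s, forall v, eval t v = h v) -> termmap f ->
  termmap (fun a => (h a, f a) : tup M (s :: D)).
Proof.
move=> [t tP] ft s' x; have [[e ->]|[y ->]] := var_inv x; last exact: ft.
by case: s' / e {x}; exists t.
Qed.

Lemma termmap_tr G D : termmap (@tr _ M G D).
Proof.
elim: G => [|s G IH]; first exact: termmap_id.
exact: (termmap_comp (@termmap_tail s _) IH).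
Qed.

Lemma termmap_tl G D : termmap (@tl _ M G D).
Proof.
elim: G => [|s G IH]; first by move=> s x; case: (var_inv x).
apply: termmap_cons; first by exists (Var (VZ s _)).
exact: (termmap_comp (@termmap_tail s _) IH).
Qed.

Lemma termmap_cat G D P (f : tup M G -> tup M D) (g : tup M G -> tup M P) :
  termmap f -> termmap g -> termmap (fun a => tcat (f a) (g a)).
Proof.
elim: D f => [|s D IH] f //= ft gt; apply: termmap_cons.
  by have [t tP] := ft _ (VZ s D); exists t.
by apply: (IH (fun a => (f a).2)) => //; exact: (termmap_comp ft (@termmap_tail s _)).
Qed.

Definition zdef G (X : set (tup M G)) :=
  exists phi : formula G, forall v, sat phi v <-> X v.

Lemma zdef_preim G D (f : tup M G -> tup M D) (X : set (tup M D)) :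
  termmap f -> zdef X -> zdef (f @^-1` X).
Proof.
move=> ft [phi phiP].
suff [psi psiP] : exists psi : formula G, forall v, sat psi v <-> sat phi (f v).
  by exists psi => v; rewrite psiP phiP.
elim: phi {X phiP} G f ft => {D} [D|D s t u|D r ts|D p IHp q IHq|D s p IHp] G f ft.
- by exists Bot.
- have [t' t'P] := eval_termmap t ft; have [u' u'P] := eval_termmap u ft.
  by exists (Eq t' u') => v /=; rewrite t'P u'P.
- pose us s x := sval (cid (eval_termmap (ts s x) ft)).
  have usP s x v : eval (us s x) v = eval (ts s x) (f v) by rewrite /us; case: cid.
  exists (Rel us) => v /=.
  have -> // : ttab (fun s x => eval (us s x) v) = ttab (fun s x => eval (ts s x) (f v)).
  by apply: tupP => s x; rewrite !tget_ttab usP.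
- have [p' p'P] := IHp _ _ ft; have [q' q'P] := IHq _ _ ft.
  by exists (Imp p' q') => v /=; rewrite p'P q'P.
- have [|p' p'P] := IHp (s :: G) (fun a => (a.1, f a.2)).
    apply: termmap_cons; first by exists (Var (VZ s G)).
    exact: (termmap_comp (@termmap_tail s G) ft).
  by exists (All p') => v /=; split=> h c; have := h c; rewrite p'P.
Qed.

Lemma zdefC G (X : set (tup M G)) : zdef X -> zdef (~` X).
Proof. by move=> [phi phiP]; exists (Neg phi) => v /=; rewrite phiP. Qed.

Lemma zdef_imp G (X Y : set (tup M G)) : zdef X -> zdef Y -> zdef [set a | X a -> Y a].
Proof. by move=> [phi phiP] [psi psiP]; exists (Imp phi psi) => v /=; rewrite phiP psiP. Qed.

Lemma eq_zdef G (X Y : set (tup M G)) : (forall v, X v <-> Y v) -> zdef X -> zdef Y.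
Proof. by move=> XY [phi phiP]; exists phi => v; rewrite phiP. Qed.

Lemma zdefI G (X Y : set (tup M G)) : zdef X -> zdef Y -> zdef (X `&` Y).
Proof.
move=> Xd Yd; apply: eq_zdef (zdefC (zdef_imp Xd (zdefC Yd))) => v /=.
by split=> [|[Xv Yv] /(_ Xv)]//; apply: contra_notP => /not_andP[]; tauto.
Qed.

Lemma zdefT G : zdef [set: tup M G].
Proof. by exists (Imp Bot Bot) => v; split=> // _ []. Qed.

Lemma zdef_all G D (X : set (tup M (D ++ G))) :
  zdef X -> zdef [set a : tup M G | forall d : tup M D, X (tcat d a)].
Proof.
elim: D X => [|s D IH] X /= Xd; first by apply: eq_zdef Xd => v; split=> [h _|h]; [|exact: (h tt)].
have [phi phiP] := Xd.
have : zdef [set a : tup M (D ++ G) | forall c, X (c, a)].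
  by exists (All phi) => v /=; split=> h c; apply/phiP; exact: h.
move=> /IH; apply: eq_zdef => v /=; split=> h.
  by move=> [c d]; exact: h.
by move=> d c; exact: (h (c, d)).
Qed.

Lemma zdef_ex G D (X : set (tup M (D ++ G))) :
  zdef X -> zdef [set a : tup M G | exists d : tup M D, X (tcat d a)].
Proof.
move=> /zdefC/zdef_all/zdefC; apply: eq_zdef => v /=.
by split=> [/existsNP[d /contrapT]|[d Xd] /(_ d)]//; exists d.
Qed.

Lemma zdef_eq G D (f g : tup M G -> tup M D) :
  termmap f -> termmap g -> zdef [set a | f a = g a].
Proof.
elim: D f g => [|s D IH] f g ft gt.
  by apply: eq_zdef (zdefT G) => v /=; split=> // _; case: (f v) (g v) => -[].
have [t tP] := ft _ (VZ s D); have [u uP] := gt _ (VZ s D).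
have d1 : zdef [set a | (f a).1 = (g a).1].
  by exists (Eq t u) => v /=; rewrite tP uP.
have d2 := IH _ _ (termmap_comp ft (@termmap_tail s D)) (termmap_comp gt (@termmap_tail s D)).
apply: eq_zdef (zdefI d1 d2) => v /=.
case: (f v) (g v) => [x a] [y b] /=.
by split=> [[-> ->]|[-> ->]].
Qed.

Definition adef A G (X : set (tup M G)) :=
  exists2 phi : pformula M G, over A phi & psat phi = X.

Lemma adefP A G (X : set (tup M G)) :
  adef A X <-> exists P (p : tup M P) (Y : set (tup M (G ++ P))),
    [/\ rng p `<=` A, zdef Y & forall a, X a <-> Y (tcat a p)].
Proof.
split=> [[[P phi p] /= pA <-]|[P [p [Y [pA [phi phiP] XY]]]]].
  by exists P, p, (sat phi); split=> //; exists phi.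
exists (PFormula phi p) => //; apply/seteqP; split=> a /=.
  by move=> h; apply/XY/phiP.
by move=> /XY h; apply/phiP.
Qed.

Lemma sub_adef A B G (X : set (tup M G)) : A `<=` B -> adef A X -> adef B X.
Proof. by move=> AB [phi phiA <-]; exists phi => //; exact: subset_trans phiA AB. Qed.

Lemma zdef_adef A G (X : set (tup M G)) : zdef X -> adef A X.
Proof.
move=> Xd; apply/adefP; exists [::], tt, (@tl _ M G [::] @^-1` X); split=> //.
  exact: zdef_preim (@termmap_tl G [::]) Xd.
by move=> a; rewrite /= tl_tcat.
Qed.

Lemma adef_preim A G D (f : tup M G -> tup M D) (X : set (tup M D)) :
  termmap f -> adef A X -> adef A (f @^-1` X).
Proof.
move=> ft /adefP[P [p [Y [pA Yd XY]]]]; apply/adefP.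
exists P, p, ((fun w => tcat (f (tl w)) (tr w)) @^-1` Y); split=> //.
  apply: zdef_preim Yd; apply: termmap_cat; last exact: termmap_tr.
  exact: (termmap_comp (@termmap_tl G P) ft).
by move=> a; rewrite /= tl_tcat tr_tcat XY.
Qed.

Lemma adefC A G (X : set (tup M G)) : adef A X -> adef A (~` X).
Proof. by move=> [phi phiA <-]; exists (pNeg phi). Qed.

Lemma adefI A G (X Y : set (tup M G)) : adef A X -> adef A Y -> adef A (X `&` Y).
Proof.
move=> /adefP[P [p [X' [pA Xd XX]]]] /adefP[Q [q [Y' [qA Yd YY]]]].
apply/adefP; exists (P ++ Q), (tcat p q).
pose f (w : tup M (G ++ (P ++ Q))) := tcat (tl w) (tl (tr w)).
pose g (w : tup M (G ++ (P ++ Q))) := tcat (tl w) (tr (tr w)).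
exists ((f @^-1` X') `&` (g @^-1` Y')); split.
- by rewrite rng_tcat subUset.
- apply: zdefI; apply: zdef_preim => //; apply: termmap_cat; try exact: termmap_tl.
    exact: (termmap_comp (@termmap_tr G _) (@termmap_tl P Q)).
  exact: (termmap_comp (@termmap_tr G _) (@termmap_tr P Q)).
- move=> a; rewrite /f /g /= !tl_tcat !tr_tcat tl_tcat.
  by split=> [[/XX ? /YY ?]|[/XX ? /YY ?]].
Qed.

Lemma adefT A G : adef A [set: tup M G].
Proof. exact/zdef_adef/zdefT. Qed.

Lemma adefU A G (X Y : set (tup M G)) : adef A X -> adef A Y -> adef A (X `|` Y).
Proof.
by move=> Xd Yd; rewrite -[_ `|` _]setCK setCU; apply/adefC/adefI; exact: adefC.
Qed.

Lemma adef_ex A G D (X : set (tup M (G ++ D))) :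
  adef A X -> adef A [set a : tup M G | exists b : tup M D, X (tcat a b)].
Proof.
move=> /adefP[P [p [Y [pA Yd XY]]]]; apply/adefP.
pose f (w : tup M (D ++ (G ++ P))) := tcat (tcat (tl (tr w)) (tl w)) (tr (tr w)).
exists P, p, [set w | exists d : tup M D, Y (f (tcat d w))]; split=> //.
  apply: (@zdef_ex _ _ (f @^-1` Y)); apply: zdef_preim Yd.
  have tw := @termmap_tr D (G ++ P).
  apply: termmap_cat; last exact: (termmap_comp tw (@termmap_tr G P)).
  apply: termmap_cat; last exact: termmap_tl.
  exact: (termmap_comp tw (@termmap_tl G P)).
by move=> a /=; split=> -[b Xb]; exists b; move: Xb;
  rewrite /f !(tl_tcat, tr_tcat) => /XY.
Qed.

Lemma adef_fibre A G D (a : tup M G) (X : set (tup M (G ++ D))) :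
  adef A X -> adef (A `|` rng a) [set b | X (tcat a b)].
Proof.
move=> /adefP[P [p [Y [pA Yd XY]]]]; apply/adefP.
pose f (w : tup M (D ++ (G ++ P))) := tcat (tcat (tl (tr w)) (tl w)) (tr (tr w)).
exists (G ++ P), (tcat a p), (f @^-1` Y); split.
- by rewrite rng_tcat => c [ac|/pA]; [right|left].
- apply: zdef_preim Yd; have tw := @termmap_tr D (G ++ P).
  apply: termmap_cat; last exact: (termmap_comp tw (@termmap_tr G P)).
  apply: termmap_cat; last exact: termmap_tl.
  exact: (termmap_comp tw (@termmap_tl G P)).
- by move=> b; rewrite /f /= !(tl_tcat, tr_tcat); exact: XY.
Qed.

(** Each parameter in [p] is either in [A], and then kept in [q], or a coordinate of [a], and then
    turned into a variable; the term map [g] reassembles [p] from [a] and [q]. *)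
Lemma adef_unparam A G D (a : tup M G) (X : set (tup M D)) :
  adef (A `|` rng a) X ->
  exists2 Z : set (tup M (G ++ D)), adef A Z & forall b, X b <-> Z (tcat a b).
Proof.
move=> /adefP[P [p [Y [pA Yd XY]]]].
have [Q [q [g [qA gt gp]]]] : exists Q (q : tup M Q) (g : tup M (G ++ Q) -> tup M P),
    [/\ rng q `<=` A, termmap g & g (tcat a q) = p].
  elim: P p pA {Y Yd XY} => [|s P IH] p pA.
    exists [::], tt, (fun=> tt); split=> //; last by case: p {pA}.
    by move=> s x; case: (var_inv x).
  have [|Q [q [g [qA gt gp]]]] := IH p.2; first by move=> c pc; apply: pA; right.
  have [Ap|/rng_tget[x /= xp]] := pA _ (or_introl erefl).
    exists (s :: Q), (p.1, q), (fun w : tup M (G ++ s :: Q) => ((tr w).1, g (tcat (tl w) (tr w).2))); split.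
    - by move=> c [->|/qA].
    - apply: termmap_cons; first exact: (@termmap_tr G (s :: Q) _ (VZ s Q)).
      apply: (@termmap_comp _ _ _ (fun w : tup M (G ++ s :: Q) => tcat (tl w) (tr w).2) _ _ gt).
      apply: termmap_cat; first exact: termmap_tl.
      exact: (termmap_comp (@termmap_tr G (s :: Q)) (@termmap_tail s Q)).
    - by rewrite tl_tcat tr_tcat /= gp; case: (p).
  exists Q, q, (fun w => (tget x (tl w), g w)); split=> //.
    apply: termmap_cons gt; have [t tP] := @termmap_tl G Q _ x.
    by exists t.
  by rewrite tl_tcat gp xp; case: (p).
pose f (w : tup M ((G ++ D) ++ Q)) :=
  tcat (tr (tl w)) (g (tcat (tl (tl w)) (tr w))).
exists [set w | Y (f (tcat w q))]; last first.
  by move=> b; rewrite /f /= !(tl_tcat, tr_tcat) gp; exact: XY.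
apply/adefP; exists Q, q, (f @^-1` Y); split=> //; apply: zdef_preim Yd.
have tw := @termmap_tl (G ++ D) Q.
apply: termmap_cat; first exact: (termmap_comp tw (@termmap_tr G D)).
apply: (@termmap_comp _ _ _ (fun w : tup M ((G ++ D) ++ Q) => tcat (tl (tl w)) (tr w)) _ _ gt).
apply: termmap_cat; last exact: termmap_tr.
exact: (termmap_comp tw (@termmap_tl G D)).
Qed.

Lemma adef_eq A G D (f g : tup M G -> tup M D) :
  termmap f -> termmap g -> adef A [set a | f a = g a].
Proof. by move=> ft gt; apply: zdef_adef; exact: zdef_eq. Qed.

Lemma adef_set1 A G (a : tup M G) : rng a `<=` A -> adef A [set a].
Proof.
move=> aA; have : adef (set0 `|` rng a) [set b | tl (tcat a b) = tr (tcat a b)].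
  apply: (@adef_fibre _ _ _ a [set w | tl w = tr w]); apply: adef_eq.
    exact: termmap_tl.
  exact: termmap_tr.
rewrite set0U => /(sub_adef aA); congr adef; apply/seteqP.
by split=> b /=; rewrite tl_tcat tr_tcat.
Qed.

Lemma adef_finite A G (S : set (tup M G)) : finite_set S ->
  (forall a, S a -> rng a `<=` A) -> adef A S.
Proof.
move=> Sfin; elim/finite_ind: S / Sfin => [|S a Sfin Sa IH] SA.
  by rewrite -setCT; apply: adefC; exact: adefT.
rewrite -(setD1K Sa); apply: adefU; first exact/adef_set1/SA.
by apply: IH => b [/SA].
Qed.

(** One witness is quantified at a time: [Y] has base point [(a, b)] and, as its fibre, the fibre of
    [X] over [a] without [b]. *)
Lemma adef_atleast A G D n (X : set (tup M (G ++ D))) : adef A X ->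
  adef A [set a | atleast n [set b | X (tcat a b)]].
Proof.
elim: n G X => [|n IH] G X Xd.
  suff -> : [set a | atleast 0 [set b | X (tcat a b)]] = setT by exact: adefT.
  by apply/seteqP; split=> // a _; right.
pose Y : set (tup M ((G ++ D) ++ D)) :=
  [set w | X (tcat (tl (tl w)) (tr w)) /\ tr w <> tr (tl w)].
have tw := @termmap_tl (G ++ D) D.
have Yd : adef A Y.
  apply: adefI.
    apply: (@adef_preim _ _ _ (fun w : tup M ((G ++ D) ++ D) => tcat (tl (tl w)) (tr w))) Xd.
    apply: termmap_cat; last exact: termmap_tr.
    exact: (termmap_comp tw (@termmap_tl G D)).
  apply: adefC; apply: adef_eq; first exact: termmap_tr.
  exact: (termmap_comp tw (@termmap_tr G D)).
have := adef_ex (adefI Xd (IH _ _ Yd)); congr adef; apply/seteqP; split=> a /=.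
  move=> [b [Xb nb]]; apply/atleastS; exists b => //.
  by move: nb; congr atleast; apply/seteqP; split=> c; rewrite /Y /= !(tl_tcat, tr_tcat).
move=> /atleastS[b Xb nb]; exists b; split=> //.
by move: nb; congr atleast; apply/seteqP; split=> c; rewrite /Y /= !(tl_tcat, tr_tcat).
Qed.

End Definability.

(** * Compactness and imaginaries *)

Section Compactness.
Variables (L : language) (M : structure L).
Implicit Types (A : set {s & M s}) (G : seq (sort L)).

(** For a downward directed family, the finite intersection property is just non-emptiness of the
    members. *)
Definition fip_base T (F : set (set T)) : Prop :=
  [/\ F !=set0, forall X, F X -> X !=set0
    & forall X Y, F X -> F Y -> exists2 Z, F Z & Z `<=` X `&` Y].

(** The form of saturation used below; as a statement on definable sets it does not involve
    completing a partial type, and it passes to imaginaries. *)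
Definition kcompact (K : Type) : Prop :=
  forall A G (F : set (set (tup M G))), card_lt A K -> fip_base F ->
    (forall X, F X -> adef A X) -> exists a, forall X, F X -> X a.

(** The formulas over [A] whose solution sets belong to an ultrafilter containing [F] form a
    complete type. *)
Lemma types_fip_base A G (F : set (set (tup M G))) : fip_base F ->
  exists2 p, types A G p & forall phi, over A phi -> F (psat phi) -> p phi.
Proof.
move=> [F0 Fn Fd].
have FF : ProperFilter (filter_from F id).
  by apply: filter_from_proper => //; apply: filter_from_filter.
have [W [Wu FW]] := ultraFilterLemma FF.
exists [set phi | over A phi /\ W (psat phi)]; last first.
  by move=> phi phiA Fphi; split=> //; apply: FW; exists (psat phi).
split=> [phi []//|S Sfin Sp|phi phiA]; last first.
  by have [|] := in_ultra_setVsetC (psat phi) Wu; [left|right].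
have : W (\bigcap_(phi in S) psat phi).
  elim/finite_ind: S / Sfin Sp => [|S phi Sfin Sphi IH] Sp.
    by rewrite bigcap_set0; exact: filterT.
  rewrite -(setD1K Sphi) bigcap_setU1; apply: filterI; first by have [] := Sp _ Sphi.
  by apply: IH => psi [/Sp].
by move=> /filter_ex[a aS]; exists a.
Qed.

Lemma saturated_kcompact K : saturated K M -> kcompact K.
Proof.
move=> sat A G F Alt Fb FA; have [p pt pF] := types_fip_base A Fb.
have [a ap] := sat _ _ _ Alt pt.
by exists a => X FX; have [phi phiA Xe] := FA _ FX; rewrite -Xe; apply/ap/pF; rewrite ?Xe.
Qed.

(** A node is the word of choices leading to it, the latest choice in front. Arbitrary parameters
    are allowed: there are countably many nodes, so countably many parameters occur. *)
Definition has_tree G : Prop := exists T : seq bool -> set (tup M G),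
  [/\ forall s, adef setT (T s), forall s, T s !=set0,
      forall s b, T (b :: s) `<=` T s
    & forall s a, T (true :: s) a -> T (false :: s) a -> False].

Fixpoint branch (b : nat -> bool) n : seq bool :=
  if n is n'.+1 then b n' :: branch b n' else [::].

(* Over the countably many parameters of the tree, distinct branches extend
   to distinct types. *)
Lemma omega_stable_no_tree T G : omega_stable T -> model T M -> ~ has_tree G.
Proof.
move=> Tst TM [R [Rd Rn Rsub Rdisj]].
pose phi s := s2val (cid2 (Rd s)).
have phiR s : psat (phi s) = R s by rewrite /phi; case: cid2.
pose A := \bigcup_(s in [set: seq bool]) rng (ppar (phi s)).
have phiA s : over A (phi s) by move=> c sc; exists s.
have /countable_injP[code codeP] : countable (types A G).
  apply: Tst TM _; apply: bigcup_countable => [|s _]; first exact: countableP.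
  exact/finite_set_countable/finite_rng.
have sub b m n : (m <= n)%N -> R (branch b n) `<=` R (branch b m).
  elim: n => [|n IH]; first by rewrite leqn0 => /eqP->.
  rewrite leq_eqVlt => /orP[/eqP->//|/IH mn].
  by apply: subset_trans mn; exact: Rsub.
have tyP b : exists p, types A G p /\ forall n, p (phi (branch b n)).
  have [|p pt pF] := @types_fip_base A G [set X | exists n, X = R (branch b n)].
    split; first by exists (R (branch b 0)), 0%N.
      by move=> _ [n ->].
    move=> _ _ [m ->] [n ->]; exists (R (branch b (maxn m n))); first by eexists.
    by rewrite subsetI; split; apply: sub; rewrite ?leq_maxl ?leq_maxr.
  by exists p; split=> // n; apply: pF => //; rewrite phiR; exists n.
have {tyP}[ty tyP] := choice tyP.
have tyI b b' : ty b = ty b' -> b = b'.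
  move=> e; have [tyb _] := tyP b; case: tyb => _ fin _.
  have agree n : branch b n = branch b' n.
    elim: n => [//|n IH] /=; have [-> | bn] := eqVneq (b n) (b' n); first by rewrite IH.
    have [|a aS] := fin [set phi (branch b n.+1); phi (branch b' n.+1)] (finite_set2 _ _).
      by move=> _ [->|->]; [|rewrite e]; have [_] := tyP b; have [_] := tyP b'; auto.
    have := aS _ (or_introl erefl); have := aS _ (or_intror erefl).
    rewrite !phiR /= -IH; move: bn; case: (b n) (b' n) => -[]// _ h1 h2.
      by have [] := Rdisj _ _ h2 h1.
    by have [] := Rdisj _ _ h1 h2.
  by apply: funext => n; have [] := agree n.+1.
(* Cantor's diagonal against the injection sending [b] to [code (ty b)]: the value of [d] at its own
   code is contradictory either way. *)
pose d n := `[< exists2 b, code (ty b) = n & b n = false >].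
have cinj b b' : code (ty b) = code (ty b') -> b = b'.
  move=> e; apply: tyI; apply: codeP => //; apply: mem_set.
    by have [] := tyP b.
  by have [] := tyP b'.
case: (boolP (d (code (ty d)))) => [dd|nd].
  by have /asboolP[b /cinj-> dn] := dd; rewrite dd in dn.
by move: (nd) => /asboolP; apply; exists d => //; exact/negbTE.
Qed.

End Compactness.

Section Imaginaries.
Variables (L : language) (U : structure L).
Let N := eq_struct U.
Implicit Types (G D P : seq (sort (eq_lang U))).

(** Every sort of [eq_struct U] is a quotient of a finite product of sorts of [U], with quotient map
    [proj_elem]. Definable sets of imaginaries are handled through their preimages under
    [proj_tup]. *)
Definition lift (s : sort (eq_lang U)) : seq (sort L) :=
  match s with inl s => [:: s] | inr E => ectx E end.

Fixpoint lctx (G : seq (sort (eq_lang U))) : seq (sort L) :=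
  if G is s :: G' then lift s ++ lctx G' else [::].

Definition proj_elem (s : sort (eq_lang U)) : tup U (lift s) -> N s :=
  match s return tup U (lift s) -> N s with
  | inl s => fun a => a.1
  | inr E => @eproj _ _ E
  end.

Fixpoint proj_tup (G : seq (sort (eq_lang U))) : tup U (lctx G) -> tup N G :=
  match G return tup U (lctx G) -> tup N G with
  | [::] => fun _ => tt
  | s :: G' => fun w => (proj_elem (tl w), proj_tup (tr w))
  end.

Lemma proj_elem_surj s (c : N s) : exists w, @proj_elem s w = c.
Proof.
case: s c => [s|E] c; first by exists (c, tt).
by case: c => C [x e]; exists x; apply: eq_exist.
Qed.

Lemma eprojE (E : eqform U) x y : eproj (E := E) x = eproj y <-> sat (eform E) (tcat x y).
Proof.
have [refl sym trans] := eformP E; split=> [/(congr1 sval)/= e|xy].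
  have : eclass y y by exact: refl.
  by rewrite -e.
apply: eq_exist; apply/seteqP; split=> z /=; last exact: trans.
by apply: trans; exact: sym.
Qed.

Definition rep (c : {s & N s}) := sval (cid (proj_elem_surj (projT2 c))).

Lemma repK c : proj_elem (rep c) = projT2 c.
Proof. by rewrite /rep; case: cid. Qed.

Definition lift_set (A : set {s & N s}) : set {s & U s} :=
  \bigcup_(c in A) rng (rep c).

Lemma proj_tup_surj G (p : tup N G) A : rng p `<=` A ->
  exists2 w, proj_tup w = p & rng w `<=` lift_set A.
Proof.
elim: G p => [|s G IH] p pA; first by exists tt => //; case: p {pA}.
have [|w wp wA] := IH p.2; first by move=> c pc; apply: pA; right.
exists (tcat (rep (existT N s p.1)) w).
  by rewrite /= tl_tcat tr_tcat wp (repK (existT N s p.1)); case: (p).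
rewrite rng_tcat => c [cr|/wA//]; exists (existT N s p.1) => //.
by apply: pA; left.
Qed.

(** All symbols of [eq_lang] take their arguments in sorts of [U], so lifts of the arguments
    assemble into one tuple of [U]. This step is shared by terms and atomic formulas. *)
Lemma lift_home G (D : seq (sort L)) (ts : forall s, var (map inl D) s -> term G s) :
  (forall s (x : var (map inl D) s), exists2 f : tup U (lctx G) -> tup U (lift s),
     termmap f & forall w, proj_elem (f w) = eval (M := N) (ts s x) (proj_tup w)) ->
  exists2 g : tup U (lctx G) -> tup U D, termmap g
    & forall w, g w = home (ttab (fun s x => eval (M := N) (ts s x) (proj_tup w))).
Proof.
elim: D ts => [|s D IH] ts H.
  by exists (fun=> tt) => // s x; case: (var_inv x).
have [f ft fP] := H _ (VZ _ _).
have [g gt gP] := IH (fun s x => ts s (VS _ x)) (fun s x => H s (VS _ x)).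
exists (fun w => ((f w).1, g w)); last by move=> w /=; rewrite gP -fP.
by apply: termmap_cons gt; have [t tP] := ft _ (VZ _ _); exists t.
Qed.

(** The class of a tuple is lifted by the tuple itself, so the new function symbols disappear. *)
Lemma lift_term G s (t : term G s) :
  exists2 f : tup U (lctx G) -> tup U (lift s),
    termmap f & forall w, proj_elem (f w) = eval (M := N) t (proj_tup w).
Proof.
elim: t => {s} [s x|h ts IH].
  elim: x => {G s} [s G|s G t x [f ft fP]].
    by exists (@tl _ _ (lift s) (lctx G)) => //; exact: termmap_tl.
  exists (f \o @tr _ _ (lift s) (lctx G)); last by move=> w; exact: fP (tr w).
  exact: termmap_comp (@termmap_tr _ _ _ _) ft.
case: h ts IH => [h|E] ts IH; last first.
  have [g gt gP] := @lift_home G (ectx E) ts IH.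
  by exists g => // w /=; rewrite gP.
have [g gt gP] := @lift_home G (fdom h) ts IH.
exists (fun w => (fint (g w), tt)); last by move=> w /=; rewrite gP.
apply: (@termmap_cons _ _ _ _ [::]); last by move=> s x; case: (var_inv x).
have [t tP] := eval_termmap (App (fun s x => Var x)) gt.
exists t => w; rewrite tP /=; congr fint; apply: tupP => s x.
by rewrite tget_ttab.
Qed.

(** Equality in a quotient sort becomes the formula of its equivalence relation, and a quantifier
    over that sort becomes quantifiers over representatives, by surjectivity of [proj_elem]. *)
Lemma lift_formula G (phi : formula G) : zdef [set w | sat (M := N) phi (proj_tup w)].
Proof.
elim: phi => {G} [G|G s t u|G r ts|G p IHp q IHq|G s p IHp] /=.
- by apply: eq_zdef (zdefC (zdefT _ _)) => v /=; split=> // h; apply: h.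
- have [f ft fP] := lift_term t; have [g gt gP] := lift_term u.
  case: s t u f ft fP g gt gP => [s|E] t u f ft fP g gt gP.
    apply: eq_zdef (zdef_eq ft gt) => w /=; rewrite -fP -gP /=.
    by case: (f w) (g w) => [x []] [y []] /=; split=> [[->]|->].
  have fg := termmap_cat ft gt.
  apply: (@eq_zdef _ _ _ [set w | sat (eform E) (tcat (f w) (g w))]).
    by move=> w /=; rewrite -fP -gP; apply: iff_sym; exact: eprojE.
  by apply: (zdef_preim (X := sat (eform E)) fg); exists (eform E).
- have [g gt gP] := @lift_home G (rdom (r : rsym L)) ts (fun s x => lift_term (ts s x)).
  apply: (@eq_zdef L U _ [set w | @rint L U r (g w)]).
    by move=> w /=; rewrite gP.
  apply: (zdef_preim (X := @rint L U r) gt).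
  exists (Rel (fun s x => Var x)) => v /=.
  have -> // : ttab (fun s x => tget x v) = v by apply: tupP => s x; rewrite tget_ttab.
- exact: zdef_imp.
- apply: eq_zdef (zdef_all IHp) => w /=; split=> h c.
    by have [d <-] := proj_elem_surj c; have := h d; rewrite tl_tcat tr_tcat.
  by rewrite tl_tcat tr_tcat.
Qed.

Lemma lift_tcat G P : exists2 g : tup U (lctx G ++ lctx P) -> tup U (lctx (G ++ P)),
  termmap g & forall w, proj_tup (g w) = tcat (proj_tup (tl w)) (proj_tup (tr w)).
Proof.
elim: G => [|s G [g gt gP]]; first by exists id => //; exact: termmap_id.
pose h (w : tup U ((lift s ++ lctx G) ++ lctx P)) := tcat (tr (tl w)) (tr w).
have tw := @termmap_tl _ U (lift s ++ lctx G) (lctx P).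
have ht : termmap h.
  apply: termmap_cat; last exact: termmap_tr.
  exact: (termmap_comp tw (@termmap_tr _ _ _ _)).
exists (fun w : tup U ((lift s ++ lctx G) ++ lctx P) => tcat (tl (tl w)) (g (h w))).
  apply: termmap_cat; first exact: (termmap_comp tw (@termmap_tl _ _ _ _)).
  exact: termmap_comp ht gt.
by move=> w /=; rewrite tl_tcat tr_tcat gP /h tl_tcat tr_tcat.
Qed.

Lemma lift_adef A G (X : set (tup N G)) : adef A X ->
  adef (lift_set A) [set w | X (proj_tup w)].
Proof.
move=> /adefP[P [p [Y [pA [phi phiY] XY]]]].
have [q qp qA] := proj_tup_surj pA; have [g gt gP] := lift_tcat G P.
apply/adefP; exists (lctx P), q, (g @^-1` [set w | sat (M := N) phi (proj_tup w)]); split=> //.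
  exact: zdef_preim (lift_formula phi).
move=> w /=; rewrite gP tl_tcat tr_tcat qp.
by split=> [/XY/phiY|/phiY/XY].
Qed.

(** The preimages of the family are definable over representatives of the parameters. Each imaginary
    parameter costs finitely many elements of [U], so the parameter set stays small. *)
Lemma eq_kcompact K : ~ countable [set: K] -> kcompact U K -> kcompact N K.
Proof.
move=> Kunc Uc A G F Alt [[X0 FX0] Fn Fd] FA.
have [||X [Y FY <-]|w wP] := Uc (lift_set A) (lctx G) [set [set w | X (proj_tup w)] | X in F].
- by apply: card_lt_bigcup Alt => // c _; exact/finite_set_countable/finite_rng.
- split; first by exists [set w | X0 (proj_tup w)], X0.
    move=> _ [X FX <-]; have [a Xa] := Fn _ FX.
    by have [w wa _] := @proj_tup_surj G a setT (fun _ _ => I); exists w; rewrite /= wa.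
  move=> _ _ [X FX <-] [Y FY <-]; have [Z FZ ZXY] := Fd _ _ FX FY.
  by exists [set w | Z (proj_tup w)]; [exists Z|move=> w /ZXY].
- exact/lift_adef/FA.
- by exists (proj_tup w) => X FX; apply: (wP [set w | X (proj_tup w)]); exists X.
Qed.

Lemma eq_no_tree : (forall D : seq (sort L), ~ has_tree U D) -> forall G, ~ has_tree N G.
Proof.
move=> noU G [R [Rd Rn Rsub Rdisj]]; apply: (noU (lctx G)).
exists (fun s => [set w | R s (proj_tup w)]); split.
- by move=> s; apply: sub_adef (lift_adef (Rd s)).
- move=> s; have [a Ra] := Rn s.
  by have [w wa _] := @proj_tup_surj G a setT (fun _ _ => I); exists w; rewrite /= wa.
- by move=> s b w; exact: Rsub.
- by move=> s w; exact: Rdisj.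
Qed.

End Imaginaries.

(** * Multiplicities in a saturated structure *)

Section SaturatedStructure.
Variables (L : language) (M : structure L) (K : Type) (A : set {s & M s}).
Hypotheses (Kunc : ~ countable [set: K]) (Mcpt : kcompact M K) (Asmall : card_lt A K).
Implicit Types (G D P : seq (sort L)).

Definition tpeq G (a b : tup M G) := forall X : set (tup M G), adef A X -> X a -> X b.
Local Notation "a ~~ b" := (tpeq a b) (at level 70).

Lemma tpeq_refl G (a : tup M G) : a ~~ a. Proof. by []. Qed.

Lemma tpeq_sym G (a b : tup M G) : a ~~ b -> b ~~ a.
Proof.
by move=> ab X Xd Xb; apply: contrapT => nXa; exact: (ab _ (adefC Xd) nXa).
Qed.

Lemma tpeq_trans G (b a c : tup M G) : a ~~ b -> b ~~ c -> a ~~ c.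
Proof. by move=> ab bc X Xd /(ab _ Xd)/(bc _ Xd). Qed.

Lemma tpeq_map G D (f : tup M G -> tup M D) a b : termmap f -> a ~~ b -> f a ~~ f b.
Proof. by move=> ft ab X Xd; apply: ab _ (adef_preim ft Xd). Qed.

Lemma tpeq_tl G D (a a' : tup M G) (b b' : tup M D) :
  tcat a b ~~ tcat a' b' -> a ~~ a'.
Proof. by move=> /(tpeq_map (@termmap_tl _ M G D)); rewrite !tl_tcat. Qed.

Lemma tpeq_tr G D (a a' : tup M G) (b b' : tup M D) :
  tcat a b ~~ tcat a' b' -> b ~~ b'.
Proof. by move=> /(tpeq_map (@termmap_tr _ M G D)); rewrite !tr_tcat. Qed.

Lemma tpeq_swap G D (a a' : tup M G) (b b' : tup M D) :
  tcat a b ~~ tcat a' b' -> tcat b a ~~ tcat b' a'.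
Proof.
move=> /(tpeq_map (termmap_cat (@termmap_tr _ M G D) (@termmap_tl _ M G D))).
by rewrite !tl_tcat !tr_tcat.
Qed.

Lemma tpeq_swap12 G D P (a a' : tup M G) (b b' : tup M D) (c c' : tup M P) :
  tcat (tcat a b) c ~~ tcat (tcat a' b') c' -> tcat (tcat b a) c ~~ tcat (tcat b' a') c'.
Proof.
pose f (w : tup M ((G ++ D) ++ P)) := tcat (tcat (tr (tl w)) (tl (tl w))) (tr w).
have ft : termmap f.
  have tw := @termmap_tl _ M (G ++ D) P.
  apply: termmap_cat; last exact: termmap_tr.
  apply: termmap_cat; first exact: (termmap_comp tw (@termmap_tr _ M G D)).
  exact: (termmap_comp tw (@termmap_tl _ M G D)).
by move=> /(tpeq_map ft); rewrite /f !(tl_tcat, tr_tcat).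
Qed.

Lemma tpeq_swap23 G D P (a a' : tup M G) (b b' : tup M D) (c c' : tup M P) :
  tcat (tcat a b) c ~~ tcat (tcat a' b') c' -> tcat (tcat a c) b ~~ tcat (tcat a' c') b'.
Proof.
pose f (w : tup M ((G ++ D) ++ P)) := tcat (tcat (tl (tl w)) (tr w)) (tr (tl w)).
have ft : termmap f.
  have tw := @termmap_tl _ M (G ++ D) P.
  apply: termmap_cat; last exact: (termmap_comp tw (@termmap_tr _ M G D)).
  apply: termmap_cat; last exact: termmap_tr.
  exact: (termmap_comp tw (@termmap_tl _ M G D)).
by move=> /(tpeq_map ft); rewrite /f !(tl_tcat, tr_tcat).
Qed.

Lemma tp_eqP G (a b : tup M G) : tp a A = tp b A <-> a ~~ b.
Proof.
split=> [e X [phi phiA <-] ha|ab].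
  have : tp a A phi by [].
  by rewrite e => -[].
apply/seteqP; split=> phi [phiA h]; split=> //; last apply: tpeq_sym ab _ _ h.
  by apply: ab h; exists phi.
by exists phi.
Qed.

Lemma card_lt_rng G (a : tup M G) : card_lt (A `|` rng a) K.
Proof.
apply: card_ltU => //; apply: card_lt_countable => //.
exact/finite_set_countable/finite_rng.
Qed.

Arguments card_lt_rng {G} a.

(** This does the work of an automorphism taking [a] to [a']. By compactness it suffices to realize
    one definable [Z] containing [(a, c)] over [a'], and the projection of [Z] is a definable set
    containing [a], hence [a']. *)
Lemma tpeq_ext G D (a a' : tup M G) (c : tup M D) : a ~~ a' ->
  exists c', tcat a c ~~ tcat a' c'.
Proof.
move=> aa'.
pose F := [set X | exists Z : set (tup M (G ++ D)),
  [/\ adef A Z, Z (tcat a c) & X = [set d | Z (tcat a' d)]]].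
have [|X|c' c'P] := Mcpt (F := F) (card_lt_rng a').
- split; first by exists setT, setT; split=> //; exact: adefT.
    move=> _ [Z [Zd Zac ->]].
    by apply: (aa' _ (adef_ex Zd)); exists c.
  move=> _ _ [Y [Yd Yac ->]] [Z [Zd Zac ->]]; exists [set d | (Y `&` Z) (tcat a' d)] => //.
  by exists (Y `&` Z); split=> //; exact: adefI.
- by move=> [Z [Zd Zac ->]]; exact: adef_fibre.
- by exists c' => Z Zd Zac; apply: (c'P [set d | Z (tcat a' d)]); exists Z.
Qed.

Definition invariant G (X : set (tup M G)) := forall a b, a ~~ b -> X a -> X b.

Lemma invariant_tpeq G (a : tup M G) : invariant (tpeq a).
Proof. by move=> b c bc ab; exact: tpeq_trans bc. Qed.

(** The recursion of [adef_atleast] again; since [X] is a mere union of types, each witness is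
    carried over by [tpeq_ext] instead of a formula. *)
Lemma atleast_invariant G D n (X : set (tup M (G ++ D))) a a' : invariant X -> a ~~ a' ->
  atleast n [set b | X (tcat a b)] -> atleast n [set b | X (tcat a' b)].
Proof.
elim: n G X a a' => [|n IH] G X a a' Xinv aa'; first by right.
move=> /atleastS[b Xb nb]; have [b' ab'] := tpeq_ext b aa'.
apply/atleastS; exists b'; first exact: Xinv ab' Xb.
pose Y : set (tup M ((G ++ D) ++ D)) :=
  [set w | X (tcat (tl (tl w)) (tr w)) /\ tr w <> tr (tl w)].
have YE x y : [set z | Y (tcat (tcat x y) z)] = [set z | X (tcat x z)] `\ y.
  by apply/seteqP; split=> z; rewrite /Y /= !(tl_tcat, tr_tcat).
rewrite -YE; apply: (IH _ _ (tcat a b)) => //; last by rewrite YE.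
move=> w w' ww' [Xw nw].
have tw := @termmap_tl _ M (G ++ D) D; split.
  apply: Xinv Xw; apply: (tpeq_map (f := fun w : tup M ((G ++ D) ++ D) => tcat (tl (tl w)) (tr w))) ww'.
  apply: termmap_cat; last exact: termmap_tr.
  exact: (termmap_comp tw (@termmap_tl _ M G D)).
apply: (ww' (~` [set w : tup M ((G ++ D) ++ D) | tr w = tr (tl w)])) => //.
apply: adefC; apply: adef_eq; first exact: termmap_tr.
exact: (termmap_comp tw (@termmap_tr _ M G D)).
Qed.

Lemma ncard_invariant G D (X : set (tup M (G ++ D))) a a' : invariant X -> a ~~ a' ->
  finite_set [set b | X (tcat a b)] -> finite_set [set b | X (tcat a' b)] /\
  ncard [set b | X (tcat a' b)] = ncard [set b | X (tcat a b)].
Proof.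
move=> Xinv aa' fin.
have [fin' le] := finite_atleast (fun n => atleast_invariant Xinv (tpeq_sym aa')) fin.
have [_ ge] := finite_atleast (fun n => atleast_invariant Xinv aa') fin'.
by split=> //; apply/eqP; rewrite eqn_leq le.
Qed.

(* [orb a b] is the set of realizations of tp(b/Aa), and [deg a b] is m(b/Aa). *)
Definition orb G D (a : tup M G) (b : tup M D) : set (tup M D) :=
  [set b' | tcat a b ~~ tcat a b'].
Definition alg G D (a : tup M G) (b : tup M D) := finite_set (orb a b).
Definition deg G D (a : tup M G) (b : tup M D) := ncard (orb a b).
Definition ialg G D (a : tup M G) (b : tup M D) := alg a b /\ alg b a.

(** Sets definable over [A] and [a] are exactly the fibres over [a] of [A]-definable sets, by
    [adef_fibre] and [adef_unparam]. *)
Lemma real_tp G D (a : tup M G) (b : tup M D) : real (tp b (A `|` rng a)) = orb a b.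
Proof.
apply/seteqP; split=> b' /= h.
  move=> X Xd Xab; have [phi phiA phiX] := adef_fibre a Xd.
  have : psat phi b' by apply: h; split=> //; rewrite phiX.
  by rewrite phiX.
move=> phi [phiA phib]; have [|Z Zd ZX] := @adef_unparam _ _ A _ _ a (psat phi).
  by exists phi.
by apply/ZX; apply: h => //; apply/ZX.
Qed.

Lemma mult_deg G D (a : tup M G) (b : tup M D) : mult b (A `|` rng a) = deg a b.
Proof. by rewrite /mult real_tp. Qed.

(** These are the intersections of [A]-definable sets, that is, the sets type-definable over [A]. *)
Definition closed G (X : set (tup M G)) :=
  forall a, ~ X a -> exists Z, [/\ adef A Z, X `<=` Z & ~ Z a].

Lemma closed_invariant G (X : set (tup M G)) : closed X -> invariant X.
Proof.
move=> Xc a b ab Xa; apply: contrapT => /Xc[Z [Zd XZ]]; apply.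
exact/(ab _ Zd)/XZ.
Qed.

Lemma closed_tpeq G (a : tup M G) : closed (tpeq a).
Proof.
by move=> b /existsNP[Z /not_implyP[Zd /not_implyP[Za nZb]]]; exists Z; split=> // c; apply.
Qed.

(** Otherwise compactness yields a point outside the fibre [Xa] that lies in the fibre over [a] of
    every definable set containing [X], against closedness. Finiteness of [Xa] makes its complement
    definable, at the price of adding its points to the parameters. *)
Lemma closed_fibre G D (X : set (tup M (G ++ D))) a : closed X ->
  finite_set [set b | X (tcat a b)] ->
  exists Z, [/\ adef A Z, X `<=` Z & forall b, Z (tcat a b) -> X (tcat a b)].
Proof.
move=> Xc fin; apply: contrapT => no.
pose Xa := [set b | X (tcat a b)].
pose F := [set Y | exists Z : set (tup M (G ++ D)),
  [/\ adef A Z, X `<=` Z & Y = [set b | Z (tcat a b)] `\` Xa]].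
pose B := A `|` rng a `|` \bigcup_(b in Xa) rng b.
have Bsmall : card_lt B K.
  apply: card_ltU => //; first exact: card_lt_rng.
  apply: card_lt_countable => //; apply: bigcup_countable => [|b _].
    exact: finite_set_countable.
  exact/finite_set_countable/finite_rng.
have [|Y|b bP] := Mcpt (F := F) Bsmall.
- split.
  + by exists (setT `\` Xa), setT; split=> //; exact: adefT.
  + move=> _ [Z [Zd XZ ->]]; apply: contrapT => empty; apply: no.
    exists Z; split=> // b Zb; apply: contrapT => nXb; apply: empty.
    by exists b.
  + move=> _ _ [Y [Yd XY ->]] [Z [Zd XZ ->]].
    exists ([set b | (Y `&` Z) (tcat a b)] `\` Xa).
      by exists (Y `&` Z); split=> //; [exact: adefI|rewrite subsetI].
    by move=> b [[? ?] ?].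
- move=> [Z [Zd XZ ->]]; apply: adefI.
    by apply: sub_adef (adef_fibre a Zd) => c h; left.
  by apply/adefC/adef_finite => // b Xb c bc; right; exists b.
have nXb : ~ X (tcat a b).
  have [|_] := bP (setT `\` Xa); last by [].
  by exists setT; split=> //; exact: adefT.
have [Z [Zd XZ nZ]] := Xc _ nXb.
have [|Zb _] := bP ([set b | Z (tcat a b)] `\` Xa); last exact: nZ.
by exists Z.
Qed.

(** By [closed_fibre] a finite orbit is cut out by a single formula. As [acl] concerns single
    elements, that formula is projected to the coordinate [x] of [b] where [c] occurs. *)
Lemma alg_acl G D (a : tup M G) (b : tup M D) : alg a b -> rng b `<=` acl (A `|` rng a).
Proof.
move=> fin c bc; have [x xc] := rng_tget bc.
have [Z [Zd abZ Zfin]] := closed_fibre (@closed_tpeq _ (tcat a b)) fin.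
have Ed : adef (A `|` rng a) [set w : tup M ([:: projT1 c] ++ D) |
    tl w = (tget x (tr w), tt) /\ Z (tcat a (tr w))].
  apply: adefI.
    apply: adef_eq; first exact: termmap_tl.
    apply: (@termmap_cons _ _ _ _ [::]); last by move=> s y; case: (var_inv y).
    by have [t tP] := @termmap_tr _ M [:: projT1 c] D _ x; exists t.
  apply: (adef_preim (X := [set y | Z (tcat a y)]) (@termmap_tr _ M [:: projT1 c] D)).
  exact: (adef_fibre a Zd).
have [phi phiA phiE] := adef_ex Ed; exists phi; split=> //.
  by rewrite phiE; exists b; rewrite /= xc; split=> //; apply: abZ.
apply: sub_finite_set (finite_image (fun y => (tget x y, tt)) fin).
rewrite phiE => -[d []] [y] /= [[->] /Zfin h].
by exists y; first exact: h.
Qed.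

Lemma tpeq_orb G D (a a' : tup M G) (b b' : tup M D) :
  tcat a b ~~ tcat a' b' -> alg a b -> alg a' b' /\ deg a' b' = deg a b.
Proof.
move=> e fin.
have -> : deg a' b' = ncard [set y | tcat a b ~~ tcat a' y].
  congr ncard; apply/seteqP; split=> y h; first exact: tpeq_trans h.
  by apply: tpeq_trans h; exact: tpeq_sym.
have [fin' en] := ncard_invariant (@invariant_tpeq _ (tcat a b)) (tpeq_tl e) fin.
split; last exact: en.
apply: sub_finite_set fin' => y h; exact: tpeq_trans h.
Qed.

(** A conjugate [c'] of [c] over [a] comes with a conjugate [b'] of [b] over [a] such that [(b, c)]
    and [(b', c')] have the same type: finitely many [b'], and finitely many [c'] for each. *)
Lemma alg_trans G D P (a : tup M G) (b : tup M D) (c : tup M P) :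
  alg a b -> alg b c -> alg a c.
Proof.
move=> ab bc.
apply: (@sub_finite_set _ _ (\bigcup_(b' in orb a b) [set c' | tcat b c ~~ tcat b' c'])).
  move=> c' ac; have [b' h] := tpeq_ext b ac; exists b'.
    exact: (tpeq_tl (tpeq_swap23 h)).
  exact: (tpeq_swap (tpeq_tl (tpeq_swap23 (tpeq_swap12 h)))).
apply: bigcup_finite => // b' abb'.
by have [] := ncard_invariant (@invariant_tpeq _ (tcat b c)) (tpeq_tr abb') bc.
Qed.

Lemma alg_tcat G D P (a : tup M G) (b : tup M D) (c : tup M P) :
  alg a c -> alg (tcat a b) c.
Proof. by apply: sub_finite_set => c' /tpeq_swap23/tpeq_tl. Qed.

Lemma deg_gt0 G D (a : tup M G) (b : tup M D) : alg a b -> (0 < deg a b)%N.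
Proof. by move=> fin; apply: ncard_gt0 => //; exists b; exact: tpeq_refl. Qed.

(** [E] is the set of realizations of tp(bc/Aa). It fibres over the realizations of tp(b/Aa), and
    invariance gives all fibres the same size. *)
Lemma ncard_orb2 G D P (a : tup M G) (b : tup M D) (c : tup M P) : alg a b -> alg a c ->
  let E := [set z | tcat (tcat a b) c ~~ tcat (tcat a z.1) z.2] in
  finite_set E /\ ncard E = (deg a b * deg (tcat a b) c)%N.
Proof.
move=> ab ac /=; set E := [set _ | _].
have -> : E = orb a b `*`` (fun b' => [set c' | tcat (tcat a b) c ~~ tcat (tcat a b') c']).
  apply/seteqP; split=> -[b' c'] /=; last by case.
  by move=> h; split=> //; exact: tpeq_tl h.
apply: ncardX => // b' abb'; apply: ncard_invariant => //.
  exact: invariant_tpeq.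
by apply: sub_finite_set ac => c' /tpeq_swap23/tpeq_tl.
Qed.

Lemma deg_mul G D P (a : tup M G) (b : tup M D) (c : tup M P) : alg a b -> alg a c ->
  (deg a b * deg (tcat a b) c = deg a c * deg (tcat a c) b)%N.
Proof.
move=> ab ac; have [_ <-] := ncard_orb2 ab ac; have [fin <-] := ncard_orb2 ac ab.
apply: eq_ncard fin.
have <- : (fun z => (z.2, z.1)) @` [set z | tcat (tcat a b) c ~~ tcat (tcat a z.1) z.2]
   = [set z | tcat (tcat a c) b ~~ tcat (tcat a z.1) z.2].
  apply/seteqP; split=> [_ [[y z] /= h <-]|[y z] /= h]; first exact: tpeq_swap23.
  by exists (z, y) => //; exact: tpeq_swap23.
by rewrite card_eq_sym; apply: inj_card_eq => -[u v] [u' v'] _ _ [-> ->].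
Qed.

Lemma deg_swap G D P (a : tup M G) (b : tup M D) (c : tup M P) :
  deg (tcat a b) c = deg (tcat b a) c.
Proof. by congr ncard; apply/seteqP; split=> d /tpeq_swap12. Qed.

Definition ratio G D (a : tup M G) (b : tup M D) : rat := ((deg a b)%:R / (deg b a)%:R)%R.

Lemma ratio_gt0 G D (a : tup M G) (b : tup M D) : ialg a b -> (0 < ratio a b)%R.
Proof. by move=> [ab ba]; rewrite divr_gt0 ?ltr0n ?deg_gt0. Qed.

(** [p], [q], [r] are the multiplicities of one of the three tuples over the other two. Counting
    pairs over each of [a], [b], [c] in both orders gives three equations, in whose combination [p],
    [q], [r] cancel. *)
Lemma ratio_mul G D P (a : tup M G) (b : tup M D) (c : tup M P) :
  ialg a b -> ialg b c -> ratio a c = (ratio a b * ratio b c)%R.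
Proof.
move=> [ab ba] [bc cb]; have ac := alg_trans ab bc; have ca := alg_trans cb ba.
have e1 := deg_mul ac ab; have e2 := deg_mul cb ca; have e3 := deg_mul bc ba.
move: e1 e2 e3; rewrite (deg_swap c a) (deg_swap c b) (deg_swap b a).
set p := deg (tcat a c) b; set q := deg (tcat a b) c; set r := deg (tcat b c) a.
move=> e1 e2 e3.
have h1 : ((deg a c)%:R * p%:R = (deg a b)%:R * q%:R :> rat)%R by rewrite -!natrM e1.
have h2 : ((deg c b)%:R * r%:R = (deg c a)%:R * p%:R :> rat)%R by rewrite -!natrM e2.
have h3 : ((deg b c)%:R * r%:R = (deg b a)%:R * q%:R :> rat)%R by rewrite -!natrM e3.
have n0 G' D' (u : tup M G') (v : tup M D') : alg u v -> ((deg u v)%:R != 0 :> rat)%R.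
  by move=> uv; rewrite pnatr_eq0 -lt0n deg_gt0.
have p0 : (p%:R != 0 :> rat)%R by apply/n0/alg_tcat.
have q0 : (q%:R != 0 :> rat)%R by apply/n0/alg_tcat.
have r0 : (r%:R != 0 :> rat)%R by apply/n0/alg_tcat.
rewrite /ratio -(mulfK q0 (deg a b)%:R)%R -h1 -(mulfK r0 (deg b c)%:R)%R h3 -(mulfK r0 (deg c b)%:R)%R h2.
by field; apply/and5P; split=> //; exact: n0.
Qed.

(* This is unimodularity over [A], by [mult_deg]. *)
Hypothesis deg_sym : forall G (a b : tup M G), a ~~ b -> ialg a b -> deg a b = deg b a.

(** Moving [a'] to [a] takes [b'] to some [b2] and keeps the ratio. Now [b] and [b2] have the same
    type and are interalgebraic through [a], so [ratio b b2] is 1 by [deg_sym], and multiplicativity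
    concludes. *)
Lemma ratio_tpeq G D (a a' : tup M G) (b b' : tup M D) :
  a ~~ a' -> b ~~ b' -> ialg a b -> ialg a' b' -> ratio a b = ratio a' b'.
Proof.
move=> aa' bb' [ab ba] [ab' ba']; have [b2 e] := tpeq_ext b' (tpeq_sym aa').
have [ab2 d1] := tpeq_orb e ab'; have [ba2 d2] := tpeq_orb (tpeq_swap e) ba'.
have -> : ratio a' b' = ratio a b2 by rewrite /ratio d1 d2.
have bb2 : ialg b b2 by split; [exact: alg_trans ba ab2|exact: alg_trans ba2 ab].
rewrite (@ratio_mul _ _ _ a b b2)// [ratio b b2]/ratio deg_sym//; last first.
  by apply: tpeq_trans bb' _; exact: tpeq_tr e.
by rewrite divff ?mulr1// pnatr_eq0 -lt0n deg_gt0//; case: bb2.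
Qed.

(* Peel off, one at a time, the complete types of pairs making up [W]. *)
Lemma ncard_ratio G D (W : set (tup M (G ++ D))) (a : tup M G) (b : tup M D) (l : rat) :
  invariant W -> (forall x y, W (tcat x y) -> a ~~ x /\ b ~~ y) ->
  finite_set [set y | W (tcat a y)] -> finite_set [set x | W (tcat x b)] ->
  (forall y, W (tcat a y) -> ialg a y /\ ratio a y = l) ->
  ((ncard [set y | W (tcat a y)])%:R = l * (ncard [set x | W (tcat x b)])%:R :> rat)%R.
Proof.
move nE : (ncard [set y | W (tcat a y)]) => n.
elim/ltn_ind: n W nE => n IH W nE Winv Wab fina finb Wl.
have [[y Way]|empty] := pselect (exists y, W (tcat a y)); last first.
  have e1 : [set y | W (tcat a y)] = set0.
    by apply/seteqP; split=> // y Wy; case: empty; exists y.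
  have e2 : [set x | W (tcat x b)] = set0.
    apply/seteqP; split=> // x Wx; have [ax _] := Wab _ _ Wx.
    have [y h] := tpeq_ext b (tpeq_sym ax); case: empty.
    by exists y; exact: Winv h Wx.
  by rewrite -nE e1 e2 !ncard0 mulr0.
have [[ay ya] yl] := Wl _ Way; have [_ bey] := Wab _ _ Way.
pose W' := W `\` tpeq (tcat a y).
have sa : orb a y `<=` [set y | W (tcat a y)] by move=> z /Winv; apply.
have sb : [set x | tcat a y ~~ tcat x b] `<=` [set x | W (tcat x b)].
  by move=> x /Winv; apply.
(* As [b] and [y] have the same type, peeling off the type of [(a, y)] removes [deg y a] points over
   [b] and [deg a y] points over [a], numbers whose quotient is [l]. *)
have nb : ncard [set x | tcat a y ~~ tcat x b] = deg y a.
  have [_ en] := ncard_invariant (@invariant_tpeq _ (tcat y a)) (tpeq_sym bey) ya.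
  by rewrite -[RHS]en; congr ncard; apply/seteqP; split=> x /tpeq_swap.
have W'a : [set z | W' (tcat a z)] = [set y | W (tcat a y)] `\` orb a y by [].
have W'b : [set z | W' (tcat z b)] = [set x | W (tcat x b)] `\` [set x | tcat a y ~~ tcat x b].
  by [].
have := IH (ncard [set z | W' (tcat a z)]) _ W' erefl.
rewrite W'a W'b => IH'.
rewrite (ncard_sub finb sb) nb -nE (ncard_sub fina sa) !natrD mulrDr IH'//.
- by rewrite -yl divfK// pnatr_eq0 -lt0n deg_gt0.
- by rewrite -nE (ncard_sub fina sa) -[X in (X < _)%N]add0n ltn_add2r; exact: deg_gt0.
- by move=> u v uv [Wu nu]; split; [exact: Winv uv Wu|apply: contra_not nu => h; exact: tpeq_trans h (tpeq_sym uv)].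
- by move=> u v [/Wab].
- exact: finite_setD.
- exact: finite_setD.
- by move=> z [/Wl].
Qed.

(** * Uniform correspondences *)

Lemma closed_preim G D (f : tup M G -> tup M D) (X : set (tup M D)) :
  termmap f -> closed X -> closed (f @^-1` X).
Proof.
move=> ft Xc a /Xc[Z [Zd XZ nZ]]; exists (f @^-1` Z); split=> //.
  exact: adef_preim.
by move=> b /XZ.
Qed.

Record ucorr G D (X : set (tup M G)) (Y : set (tup M D)) (R : set (tup M (G ++ D)))
    (k l : nat) : Prop := {
  ucorr_closed : closed R;
  ucorr_sub : forall x y, R (tcat x y) -> X x /\ Y y;
  ucorr_right : forall x, X x ->
    finite_set [set y | R (tcat x y)] /\ ncard [set y | R (tcat x y)] = k;
  ucorr_left : forall y, Y y ->
    finite_set [set x | R (tcat x y)] /\ ncard [set x | R (tcat x y)] = l;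
  ucorr_k : (0 < k)%N;
  ucorr_l : (0 < l)%N }.

Definition flip G D (R : set (tup M (G ++ D))) : set (tup M (D ++ G)) :=
  [set w | R (tcat (tr w) (tl w))].

Lemma flipE G D (R : set (tup M (G ++ D))) x y : flip R (tcat y x) = R (tcat x y).
Proof. by rewrite /flip /= tl_tcat tr_tcat. Qed.

Lemma ucorr_flip G D X Y (R : set (tup M (G ++ D))) k l :
  ucorr X Y R k l -> ucorr Y X (flip R) l k.
Proof.
move=> [Rc Rsub Rr Rl k0 l0]; split=> //.
- apply: (closed_preim (f := fun w => tcat (tr w) (tl w))) Rc.
  by apply: termmap_cat; [exact: termmap_tr|exact: termmap_tl].
- by move=> y x; rewrite flipE => /Rsub[].
- by move=> y /Rl; under eq_set do rewrite -flipE.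
- by move=> x /Rr; under eq_set do rewrite -flipE.
Qed.

Lemma ucorr_alg G D X Y (R : set (tup M (G ++ D))) k l x y :
  ucorr X Y R k l -> R (tcat x y) -> alg x y.
Proof.
move=> Ru Rxy; have [Xx _] := ucorr_sub Ru Rxy.
have [fin _] := ucorr_right Ru Xx; apply: sub_finite_set fin => z h.
exact: closed_invariant (ucorr_closed Ru) _ _ h Rxy.
Qed.

Lemma ucorr_ialg G D X Y (R : set (tup M (G ++ D))) k l x y :
  ucorr X Y R k l -> R (tcat x y) -> ialg x y.
Proof.
move=> Ru Rxy; split; first exact: ucorr_alg Ru Rxy.
by apply: (ucorr_alg (ucorr_flip Ru)); rewrite flipE.
Qed.

Lemma ucorr_ex G D X Y (R : set (tup M (G ++ D))) k l x :
  ucorr X Y R k l -> X x -> exists y, R (tcat x y).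
Proof.
move=> Ru /(ucorr_right Ru)[fin cardk]; apply: contrapT => empty.
have := ucorr_k Ru; rewrite -cardk.
suff -> : [set y | R (tcat x y)] = set0 by rewrite ncard0.
by apply/seteqP; split=> // y Ry; case: empty; exists y.
Qed.

(* Openness of the projection of [R] to [X]. A definable [Z] containing [R] with
   the same fibre over [a] has at most [k] points in the fibres near [a], so
   its fibres over [X] are those of [R] there. *)
Lemma ucorr_open G D X Y (R Z : set (tup M (G ++ D))) k l a b :
  ucorr X Y R k l -> R (tcat a b) -> adef A Z -> Z (tcat a b) ->
  exists T, [/\ adef A T, T a &
    forall x, X x -> T x -> exists y, R (tcat x y) /\ Z (tcat x y)].
Proof.
move=> Ru Rab Zd Zab; have [Xa _] := ucorr_sub Ru Rab.
have [fina ncarda] := ucorr_right Ru Xa.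
have [H [Hd RH Ha]] := closed_fibre (ucorr_closed Ru) fina.
have Ha' : [set y | H (tcat a y)] = [set y | R (tcat a y)].
  by apply/seteqP; split=> y; [exact: Ha|exact: RH].
exists ((~` [set x | atleast k.+1 [set y | H (tcat x y)]]) `&`
        [set x | exists y, (H `&` Z) (tcat x y)]); split.
- by apply: adefI; [exact/adefC/adef_atleast|exact/adef_ex/adefI].
- split; last by exists b; split=> //; exact: RH.
  by rewrite /= Ha' => -[//|]; rewrite ncarda ltnn.
- move=> x Xx [/atleast_finite[finH leH] [y [Hy Zy]]]; exists y; split=> //.
  have [fin cardk] := ucorr_right Ru Xx.
  have sub : [set y | R (tcat x y)] `<=` [set y | H (tcat x y)] by move=> z; exact: RH.
  apply: contrapT => nR; move: leH; rewrite (ncard_sub finH sub) cardk ltnS.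
  rewrite -[X in (_ <= X)%N]addn0 leq_add2l leqn0 => /eqP e.
  have : (0 < ncard ([set y | H (tcat x y)] `\` [set y | R (tcat x y)]))%N.
    by apply: ncard_gt0; [exact: finite_setD|exists y].
  by rewrite e.
Qed.

(** * Isolated types, minimal closed sets and finiteness *)

Definition isolated G (E : set (tup M G)) a :=
  exists Z, [/\ adef A Z, Z a & forall x, E x -> Z x -> a ~~ x].

Lemma separate_finite G (S : set (tup M G)) a : finite_set S ->
  exists Z, [/\ adef A Z, Z a & forall x, S x -> Z x -> a ~~ x].
Proof.
elim/finite_ind => [|{}S y fin Sy [Z [Zd Za ZS]]].
  by exists setT; split=> //; exact: adefT.
have [ay|] := pselect (a ~~ y).
  exists Z; split=> // x Sx; have [->//|xy] := pselect (x = y).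
  exact: ZS.
move=> /existsNP[V /not_implyP[Vd /not_implyP[Va nVy]]].
exists (Z `&` V); split=> //; first exact: adefI.
move=> x Sx [Zx Vx]; apply: ZS => //; split=> // xy.
by rewrite xy in Vx.
Qed.

(** [Z] isolates the type of [x] in [E], and [V] singles out the type of [y] in the finite fibre
    over [x]. By openness a point [y'] of [F] near [y] has a partner in [Z], thus of the type of
    [x]; moving that partner to [x] moves [y'] into the fibre over [x], still inside [V]. *)
Lemma ucorr_isolated G D X Y (R : set (tup M (G ++ D))) k l E F x y :
  ucorr X Y R k l -> F `<=` Y -> (forall u v, R (tcat u v) -> E u <-> F v) ->
  R (tcat x y) -> isolated E x -> isolated F y.
Proof.
move=> Ru FY EF Rxy [Z [Zd Zx Ziso]].
have [Xx _] := ucorr_sub Ru Rxy; have [finx _] := ucorr_right Ru Xx.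
have [V [Vd Vy Vsep]] := separate_finite y finx.
have [|||T [Td Ty TP]] := @ucorr_open _ _ _ _ _ (@tr _ M D G @^-1` Z) _ _ y x (ucorr_flip Ru).
- by rewrite flipE.
- by apply: adef_preim => //; exact: termmap_tr.
- by rewrite /= tr_tcat.
exists (T `&` V); split=> //; first exact: adefI.
move=> y' Fy' [Ty' Vy']; have [x' [Rxy' Zx']] := TP _ (FY _ Fy') Ty'.
move: Rxy' Zx'; rewrite flipE /= tr_tcat => Rxy' Zx'.
have xx' : x ~~ x' by apply: Ziso => //; exact/(EF _ _ Rxy').
have [y2 e] := tpeq_ext y' (tpeq_sym xx').
apply: tpeq_trans (tpeq_sym (tpeq_tr e)); apply: Vsep.
  exact: closed_invariant (ucorr_closed Ru) _ _ e Rxy'.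
exact: (tpeq_tr e) Vd Vy'.
Qed.

Definition stable_under G (Q : tup M G -> tup M G -> Prop) (E : set (tup M G)) :=
  forall x x', Q x x' -> E x -> E x'.

(** Zorn's lemma is available for unions, so it is applied to the part [O] removed from [X].
    Compactness keeps what remains along a chain non-empty. *)
Lemma minimal_closed G (Q : tup M G -> tup M G -> Prop) (X : set (tup M G)) :
  closed X -> X !=set0 -> stable_under Q X ->
  exists E, [/\ E `<=` X, closed E, E !=set0, stable_under Q E &
    forall E', E' `<=` E -> closed E' -> E' !=set0 -> stable_under Q E' -> E `<=` E'].
Proof.
move=> Xc Xn XQ.
pose good E := [/\ closed E, E !=set0 & stable_under Q E].
have [|O [[Oc On OQ] Omax]] := @Zorn_bigcup _ [set O | good (X `\` O)].
  (* Adding the empty set takes care of the empty chain, for which nothing is removed from [X]. *)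
  move=> C Cgood Ctot /=; pose C' := set0 |` C.
  have C'good O : C' O -> good (X `\` O) by move=> [->|/Cgood//]; rewrite setD0.
  have C'tot O O' : C' O -> C' O' -> O `<=` O' \/ O' `<=` O.
    move=> [->|CO] [->|CO']; [by left|by left|by right|exact: Ctot].
  have -> : X `\` \bigcup_(O in C) O = \bigcap_(O in C') (X `\` O).
    apply/seteqP; split=> x.
      move=> [Xx nx] O [->|CO]; split=> // Ox; apply: nx; by exists O.
    move=> h; have [Xx _] := h _ (or_introl erefl); split=> // -[O CO Ox].
    by have [_ /(_ Ox)] := h _ (or_intror CO).
  split.
  - move=> a /existsNP[O /not_implyP[CO na]]; have [Oc _ _] := C'good _ CO.
    have [Z [Zd OZ nZ]] := Oc _ na; exists Z; split=> //.
    by apply: subset_trans OZ => x; exact.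
  - pose F := [set Z | adef A Z /\ exists2 O, C' O & X `\` O `<=` Z].
    have [|Z []//|a aP] := Mcpt (F := F) Asmall.
      split.
      + by exists setT; split; [exact: adefT|exists set0 => //; left].
      + move=> Z [_ [O /C'good[_ [x Ox] _] OZ]]; exists x; exact: OZ.
      + move=> Z Z' [Zd [O CO OZ]] [Z'd [O' CO' OZ']].
        exists (Z `&` Z') => //; split; first exact: adefI.
        have [OO'|O'O] := C'tot _ _ CO CO'.
          exists O' => // x [Xx nx]; split; last exact: OZ'.
          by apply: OZ; split=> // /OO'.
        exists O => // x [Xx nx]; split; first exact: OZ.
        by apply: OZ'; split=> // /O'O.
    exists a => O CO; apply: contrapT => na; have [Oc _ _] := C'good _ CO.
    have [Z [Zd OZ]] := Oc _ na; apply; apply: aP; split=> //.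
    by exists O.
  - move=> x x' xx' h O CO; have [_ _ OQ] := C'good _ CO.
    exact: OQ xx' (h _ CO).
exists (X `\` O); split=> // E' E'sub E'c E'n E'Q.
apply: contrapT => nsub; apply: (Omax (O `|` ~` E')).
  split; first by left.
  move=> sub; apply: nsub => x [Xx nOx]; apply: contrapT => nE'.
  by apply: nOx; apply: sub; right.
rewrite /=; suff -> : X `\` (O `|` ~` E') = E' by [].
apply/seteqP; split=> x; first by move=> [_ /not_orP[_ /contrapT]].
by move=> E'x; have [Xx nO] := E'sub _ E'x; split=> // -[].
Qed.

Hypothesis no_tree : forall G, ~ has_tree M G.

(** A definable set [Z] meeting [E] at a non-isolated [x] contains a point [y] of [E] of another
    type, and a set [V] separating [x] from [y] splits [Z] into two definable pieces that both meet
    [E]. *)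
Lemma exists_isolated G (E : set (tup M G)) : E !=set0 -> exists2 a, E a & isolated E a.
Proof.
move=> En; apply: contrapT => no; apply: (no_tree (G := G)).
pose meets := {Z : set (tup M G) | adef A Z /\ E `&` Z !=set0}.
have split (Z : meets) : exists W : meets * meets,
    [/\ sval W.1 `<=` sval Z, sval W.2 `<=` sval Z & forall x, sval W.1 x -> ~ sval W.2 x].
  case: Z => Z [Zd [x [Ex Zx]]].
  have : ~ isolated E x by move=> iso; apply: no; exists x.
  move=> /forallNP/(_ Z)/not_and3P[//|//|/existsNP[y /not_implyP[Ey /not_implyP[Zy]]]].
  move=> /existsNP[V /not_implyP[Vd /not_implyP[Vx nVy]]].
  have h1 : adef A (Z `&` V) /\ E `&` (Z `&` V) !=set0.
    by split; [exact: adefI|exists x].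
  have h2 : adef A (Z `\` V) /\ E `&` (Z `\` V) !=set0.
    by split; [apply: adefI => //; exact: adefC|exists y].
  pose P W := adef A W /\ E `&` W !=set0.
  by exists (exist P _ h1, exist P _ h2); split=> [z []|z []|z [_ Vz] []].
have [f fP] := choice split.
have top : adef A [set: tup M G] /\ E `&` setT !=set0 by split; [exact: adefT|rewrite setIT].
pose R := fix R (s : seq bool) : meets := match s with
  | [::] => exist (fun W => adef A W /\ E `&` W !=set0) setT top
  | b :: s => if b then (f (R s)).1 else (f (R s)).2 end.
exists (fun s => sval (R s)); split.
- by move=> s; case: (svalP (R s)) => + _; apply: sub_adef.
- by move=> s; case: (svalP (R s)) => _ [x [_ Zx]]; exists x.
- by move=> s b /=; have [h1 h2 _] := fP (R s); case: b.
- by move=> s a /=; have [_ _ h] := fP (R s); exact: h.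
Qed.

Definition covers G (s : seq (tup M G)) x := has (fun y => `[< y ~~ x >]) s.

(** The Cantor-Bendixson derivative of [E]. A set isolating a point of [E] contains no non-isolated
    point of [E], so its complement is a definable neighbourhood of the derivative. *)
Lemma closed_derived G (E : set (tup M G)) : closed E -> closed (E `\` isolated E).
Proof.
move=> Ec a /not_andP[/Ec[Z [Zd EZ nZ]]|/contrapT[Z [Zd Za Zi]]].
  by exists Z; split=> // x [/EZ].
exists (~` Z); split; [exact: adefC| |by move=> /(_ Za)].
move=> x [Ex nix] Zx; apply: nix; exists Z; split=> // y Ey Zy.
by apply: tpeq_trans (tpeq_sym (Zi _ Ex Zx)) _; exact: Zi.
Qed.

(** A compact discrete space is finite. If no finite list covers [E], some [a] lies in every
    definable set that contains [E] up to finitely many types; then [a] is in [E], yet the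
    complement of a set isolating [a] is one of these sets. *)
Lemma isolated_cover G (E : set (tup M G)) : closed E -> E `<=` isolated E ->
  exists s, forall x, E x -> covers s x.
Proof.
move=> Ec Eiso; apply: contrapT => no.
pose F := [set Z | adef A Z /\ exists s, forall x, E x -> ~~ covers s x -> Z x].
have [|Z []//|a aP] := Mcpt (F := F) Asmall.
  split.
  - by exists setT; split; [exact: adefT|exists [::]].
  - move=> Z [_ [s sZ]]; apply: contrapT => Z0; apply: no; exists s => x Ex.
    by apply/negPn/negP => /(sZ _ Ex) Zx; apply: Z0; exists x.
  - move=> Z Z' [Zd [s sZ]] [Z'd [s' sZ']]; exists (Z `&` Z') => //; split; first exact: adefI.
    exists (s ++ s') => x Ex; rewrite /covers has_cat negb_or => /andP[? ?].
    by split; [exact: sZ|exact: sZ'].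
have [Ea|nEa] := pselect (E a); last first.
  have [Z [Zd EZ]] := Ec _ nEa; apply; apply: aP; split=> //.
  by exists [::] => x /EZ.
have [Z [Zd Za Zi]] := Eiso _ Ea.
apply: (aP (~` Z)) => //; split; first exact: adefC.
exists [:: a] => x Ex; rewrite /covers /= orbF => /asboolP nax Zx.
by apply: nax; exact: Zi.
Qed.

Lemma finite_cover G (S : set (tup M G)) : finite_set S ->
  exists s, forall x, S x -> covers s x.
Proof.
elim/finite_ind => [|{}S x _ _ [s sP]]; first by exists [::].
exists (x :: s) => y Sy; rewrite /covers /=.
have [->|yx] := pselect (y = x); first by rewrite asboolT.
by rewrite [has _ _]sP ?orbT.
Qed.

(** A type that [R] meets over a conjugate of [a] is already met over [a] itself, where the fibre is
    finite. *)
Lemma ucorr_cover G D X Y (R : set (tup M (G ++ D))) k l s :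
  ucorr X Y R k l -> exists t, forall x y, covers s x -> R (tcat x y) -> covers t y.
Proof.
move=> Ru; elim: s => [|a s [t tP]]; first by exists [::].
have [Xa|nXa] := pselect (X a); last first.
  exists t => x y /orP[/asboolP ax Rxy|]; last exact: tP.
  have [y' e] := tpeq_ext y (tpeq_sym ax).
  have /(ucorr_sub Ru)[//] : R (tcat a y').
  exact: closed_invariant (ucorr_closed Ru) _ _ e Rxy.
have [fin _] := ucorr_right Ru Xa; have [t' t'P] := finite_cover fin.
exists (t' ++ t) => x y; rewrite /covers has_cat => /orP[/asboolP ax Rxy|sx Rxy].
  have [y' e] := tpeq_ext y (tpeq_sym ax).
  have Ray' : R (tcat a y') by exact: closed_invariant (ucorr_closed Ru) _ _ e Rxy.
  apply/orP; left; have := t'P _ Ray'; apply: sub_has => z /asboolP zy'.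
  by apply/asboolP; apply: tpeq_trans zy' _; apply: tpeq_sym; exact: tpeq_tr e.
by apply/orP; right; exact: tP sx Rxy.
Qed.

(** * Weights relative to a base point, and double counting *)

Lemma ucorr_transfer G D X Y (R : set (tup M (G ++ D))) k l P (o : tup M P) x y :
  ucorr X Y R k l -> R (tcat x y) ->
  (exists x', x ~~ x' /\ ialg o x') -> exists y', y ~~ y' /\ ialg o y'.
Proof.
move=> Ru Rxy [x' [xx' [ox xo]]]; have [y' e] := tpeq_ext y xx'.
have Rxy' : R (tcat x' y') by exact: closed_invariant (ucorr_closed Ru) _ _ e Rxy.
have [xy yx] := ucorr_ialg Ru Rxy'.
exists y'; split; first exact: tpeq_tr e.
by split; [exact: alg_trans ox xy|exact: alg_trans yx xo].
Qed.

(** A point of [E] need not itself be interalgebraic with [o]; some realization [x'] of its type is,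
    and by [ratio_tpeq] the choice of [x'] does not matter. *)
Definition weighted G P (o : tup M P) (E : set (tup M G)) (w : tup M G -> rat) :=
  forall x, E x -> exists x', [/\ x ~~ x', ialg o x' & w x = ratio o x'].

Lemma weightedP G P (o : tup M P) (E : set (tup M G)) :
  (forall x, E x -> exists x', x ~~ x' /\ ialg o x') -> exists w, weighted o E w.
Proof.
move=> H; have [w wP] : {w : tup M G -> rat & forall x, E x ->
    exists x', [/\ x ~~ x', ialg o x' & w x = ratio o x']}.
  apply: (@choice _ _ (fun x r => E x ->
    exists x', [/\ x ~~ x', ialg o x' & r = ratio o x'])) => x.
  have [/H[x' [xx' ox]]|nE] := pselect (E x); last by exists 0%R.
  by exists (ratio o x') => _; exists x'.
by exists w.
Qed.

(** Realizations [x'] and [y'] interalgebraic with [o] are interalgebraic with each other, so the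
    ratio can be computed there through [o]. *)
Lemma weighted_ratio G D P (o : tup M P) E F w v (x : tup M G) (y y1 : tup M D) :
  weighted o E w -> weighted o F v -> E x -> F y -> y ~~ y1 -> ialg x y1 ->
  ratio x y1 = (v y / w x)%R.
Proof.
move=> wE vF /wE[x' [xx' ox' ->]] /vF[y' [yy' oy' ->]] yy1 xy1.
have x'y' : ialg x' y'.
  by case: ox' oy' => ? ? [? ?]; split; [apply: alg_trans|apply: alg_trans]; eauto.
rewrite (@ratio_mul _ _ _ o x' y')// mulrC mulKf; last exact/lt0r_neq0/ratio_gt0.
by apply: ratio_tpeq => //; exact: tpeq_trans (tpeq_sym yy1) yy'.
Qed.

Lemma ucorr_weight G D X Y (R : set (tup M (G ++ D))) k l P (o : tup M P) E F w v s t :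
  ucorr X Y R k l -> E `<=` X -> F `<=` Y ->
  (forall x y, R (tcat x y) -> E x <-> F y) ->
  weighted o E w -> weighted o F v -> distinct (@tpeq G) s -> distinct (@tpeq D) t ->
  (forall x, E x -> covers s x) -> (forall y, F y -> covers t y) ->
  all (fun x => `[< E x >]) s -> all (fun y => `[< F y >]) t ->
  (k%:R * (\sum_(x <- s) w x) = l%:R * (\sum_(y <- t) v y))%R.
Proof.
move=> Ru EX FY EF wE vF sd td sE tF.
move=> /all_filterP sall /all_filterP tall; rewrite -sall -tall !big_filter.
(* [n x y] and [m x y] count the pairs of [R] between the types of [x] and [y] as seen from [x] and
   from [y]. Summed over types they give [k] and [l], and [ncard_ratio] compares them term by
   term. *)
pose n x y := ncard ([set z | R (tcat x z)] `&` tpeq y).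
pose m x y := ncard ([set z | R (tcat z y)] `&` tpeq x).
have kE x : E x -> k = (\sum_(y <- t | `[< F y >]) n x y)%N.
  move=> Ex; have [fin <-] := ucorr_right Ru (EX _ Ex).
  rewrite -big_filter tall; apply: ncard_classes => //.
    by move=> a b c ac /tpeq_sym; exact: tpeq_trans.
  by move=> y Ry; apply: tF; exact/(EF _ _ Ry).
have lE y : F y -> l = (\sum_(x <- s | `[< E x >]) m x y)%N.
  move=> Fy; have [fin <-] := ucorr_left Ru (FY _ Fy).
  rewrite -big_filter sall; apply: ncard_classes => //.
    by move=> a b c ac /tpeq_sym; exact: tpeq_trans.
  by move=> x Rx; apply: sE; exact/(EF _ _ Rx).
have nm x y : E x -> F y -> ((n x y)%:R * w x = (m x y)%:R * v y)%R.
  move=> Ex Fy.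
  pose W := R `&` [set u | tpeq x (tl u) /\ tpeq y (tr u)].
  have Wa : [set z | W (tcat x z)] = [set z | R (tcat x z)] `&` tpeq y.
    apply/seteqP; split=> z; rewrite /W /= tl_tcat tr_tcat; first by move=> [? []].
    by move=> [? ?]; split=> //; split=> //; exact: tpeq_refl.
  have Wb : [set z | W (tcat z y)] = [set z | R (tcat z y)] `&` tpeq x.
    apply/seteqP; split=> z; rewrite /W /= tl_tcat tr_tcat; first by move=> [? []].
    by move=> [? ?]; split=> //; split=> //; exact: tpeq_refl.
  have w0 : (w x != 0)%R.
    by have [x' [_ ox' ->]] := wE _ Ex; exact/lt0r_neq0/ratio_gt0.
  rewrite /n /m -Wa -Wb (@ncard_ratio _ _ W x y (v y / w x)%R).
  - by rewrite mulrAC divfK// mulrC.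
  - move=> u u' uu' [Ru0 [xu yu]]; split; first exact: closed_invariant (ucorr_closed Ru) _ _ uu' Ru0.
    split; first exact: tpeq_trans xu (tpeq_map (@termmap_tl _ M G D) uu').
    exact: tpeq_trans yu (tpeq_map (@termmap_tr _ M G D) uu').
  - by move=> u u' [_]; rewrite /= tl_tcat tr_tcat.
  - by rewrite Wa; apply: finite_setIl; have [] := ucorr_right Ru (EX _ Ex).
  - by rewrite Wb; apply: finite_setIl; have [] := ucorr_left Ru (FY _ Fy).
  - move=> y1 [Rxy1]; rewrite /= tr_tcat => -[_ yy1].
    have xy1 := ucorr_ialg Ru Rxy1; split=> //.
    exact: weighted_ratio wE vF Ex Fy yy1 xy1.
rewrite !mulr_sumr.
transitivity (\sum_(x <- s | `[< E x >]) \sum_(y <- t | `[< F y >]) (n x y)%:R * w x)%R.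
  by apply: eq_bigr => x /asboolP Ex; rewrite (kE _ Ex) natr_sum mulr_suml.
rewrite exchange_big; apply: eq_bigr => y /asboolP Fy.
rewrite (lE _ Fy) natr_sum mulr_suml; apply: eq_bigr => x /asboolP Ex.
exact: nm.
Qed.

Theorem ucorr_unique G D X Y (R1 R2 : set (tup M (G ++ D))) k1 l1 k2 l2 :
  closed X -> X !=set0 -> ucorr X Y R1 k1 l1 -> ucorr X Y R2 k2 l2 ->
  (k1%:R / l1%:R = k2%:R / l2%:R :> rat)%R.
Proof.
move=> Xc Xn R1u R2u.
pose C x y := R1 (tcat x y) \/ R2 (tcat x y).
pose Q x x' := exists y, C x y /\ C x' y.
have CX x y : C x y -> X x /\ Y y.
  by case=> [/(ucorr_sub R1u)|/(ucorr_sub R2u)].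
have [|E [EX Ec En EQ Emin]] := @minimal_closed _ Q _ Xc Xn.
  by move=> x x' [y [_ /CX[]]].
(* The counterpart of [E] in [Y]. As [E] is stable under [Q], one partner of [y] lying in [E] forces
   all of them to. *)
pose F y := Y y /\ forall x, C x y -> E x.
have CEF x y : C x y -> E x <-> F y.
  move=> Cxy; split=> [Ex|[_]]; last exact.
  by split=> [|x' Cx'y]; [have [] := CX _ _ Cxy|apply: EQ Ex; exists y].
have isoF x y : C x y -> isolated E x <-> isolated F y.
  have FY : F `<=` Y by move=> ? [].
  case=> [R1xy|R2xy]; split.
  - by apply: ucorr_isolated R1u FY _ R1xy => u v Ruv; apply: CEF; left.
  - apply: (ucorr_isolated (ucorr_flip R1u) EX); last by rewrite flipE.
    by move=> u v; rewrite flipE => Rvu; apply: iff_sym; apply: CEF; left.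
  - by apply: ucorr_isolated R2u FY _ R2xy => u v Ruv; apply: CEF; right.
  - apply: (ucorr_isolated (ucorr_flip R2u) EX); last by rewrite flipE.
    by move=> u v; rewrite flipE => Rvu; apply: iff_sym; apply: CEF; right.
have Eiso : E `<=` isolated E.
  have [a Ea aiso] := exists_isolated En.
  have [E'0|/set0P E'n] := eqVneq (E `\` isolated E) set0.
    by move=> x Ex; apply: contrapT => nx; have : (E `\` isolated E) x by []; rewrite E'0.
  have /= : (E `\` isolated E) a; last by case.
  apply: (Emin _ _ (closed_derived Ec) E'n _ _ Ea); first by move=> ? [].
  move=> x x' [y [Cxy Cx'y]] [Ex nx]; split; first by apply: EQ Ex; exists y.
  by apply: contra_not nx => /(isoF _ _ Cx'y)/(isoF _ _ Cxy).
have [s0 s0P] := isolated_cover Ec Eiso.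
(* One correspondence suffices here: every point of [F] has a partner under [R1], which lies in
   [E]. *)
have [t0 t0P] := ucorr_cover s0 R1u.
have [o Eo] := En.
(* Partners under [C] are interalgebraic, so keeping the types with a realization interalgebraic
   with [o] leaves both sides matched, and every type kept has a weight. *)
pose E' x := E x /\ exists x', x ~~ x' /\ ialg o x'.
pose F' y := F y /\ exists y', y ~~ y' /\ ialg o y'.
have EF' x y : C x y -> E' x <-> F' y.
  move=> Cxy; split=> -[h1 h2]; split; try exact/(CEF _ _ Cxy).
    by case: Cxy => [R1xy|R2xy]; [exact: ucorr_transfer R1u R1xy h2|exact: ucorr_transfer R2u R2xy h2].
  by case: Cxy => [R1xy|R2xy];
    [apply: (ucorr_transfer (ucorr_flip R1u)) h2|apply: (ucorr_transfer (ucorr_flip R2u)) h2];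
    rewrite flipE.
have [s [sd sP sE]] := distinct_reps (S := E') (@tpeq_refl G) (@tpeq_sym G)
  (fun x y z => @tpeq_trans G y x z) (fun x E'x => s0P _ E'x.1).
have t0F y : F' y -> covers t0 y.
  move=> [[Yy CE] _]; have [x] := ucorr_ex (ucorr_flip R1u) Yy.
  rewrite flipE => Rxy; apply: (t0P x) => //.
  by apply/s0P/CE; left.
have [t [td tP tF]] := distinct_reps (S := F') (@tpeq_refl D) (@tpeq_sym D)
  (fun x y z => @tpeq_trans D y x z) t0F.
have [w wE] : exists w, weighted o E' w by apply: weightedP => x [].
have [v vF] : exists v, weighted o F' v by apply: weightedP => x [].
have E'X : E' `<=` X by move=> x [/EX].
have F'Y : F' `<=` Y by move=> x [[]].
have e1 := ucorr_weight R1u E'X F'Y (fun x y h => EF' x y (or_introl h)) wE vF sd td sP tP sE tF.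
have e2 := ucorr_weight R2u E'X F'Y (fun x y h => EF' x y (or_intror h)) wE vF sd td sP tP sE tF.
have [x Xx] := Xn.
have oo : ialg o o.
  suff : alg o o by [].
  apply: sub_finite_set (finite_set1 o) => o' h.
  have := h [set u | tl u = tr u] (adef_eq A (@termmap_tl _ M G G) (@termmap_tr _ M G G)).
  by rewrite /= !tl_tcat !tr_tcat => /(_ erefl).
(* The base point belongs to [E'], so [s] is not empty, and weights are positive; this allows
   dividing by the sum. *)
have S0 : (0 < \sum_(x <- s) w x)%R.
  have so : covers s o by apply: sP; split=> //; exists o; split=> //; exact: tpeq_refl.
  rewrite -(all_filterP sE); case: (s) sE so => [//|a r] /= /andP[aE _] _.
  rewrite aE /= big_cons; apply: ltr_pwDl.
    by have [a' [_ oa' ->]] := wE _ (asboolW aE); exact: ratio_gt0.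
  rewrite big_filter; apply: sumr_ge0 => z /asboolP/wE[z' [_ oz' ->]].
  exact/ltW/ratio_gt0.
move: e1 e2 S0; set S := (\sum_(x <- s) _)%R; set V := (\sum_(y <- t) _)%R.
have l10 : (l1%:R != 0 :> rat)%R by rewrite pnatr_eq0 -lt0n; exact: ucorr_l R1u.
have l20 : (l2%:R != 0 :> rat)%R by rewrite pnatr_eq0 -lt0n; exact: ucorr_l R2u.
move=> e1 e2 /lt0r_neq0 S0.
have f k l : (l != 0 -> k * S = l * V -> k / l = V / S)%R.
  by move=> l0 e; apply/eqP; rewrite eqr_div// e mulrC.
by rewrite (f _ _ l10 e1) (f _ _ l20 e2).
Qed.

End SaturatedStructure.

(** * From the monster model to a structure with fixed parameters *)

Lemma uncountable_of_formulas L (M : structure L) K : card_lt [set: {G & @formula L G}] K ->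
  ~ countable [set: K].
Proof.
move=> lt Kc; apply: lt; apply: card_le_trans Kc _.
(* Iterated implications from [Bot] exist in every language, and their [depth] tells them apart. *)
pose F := fix F n : @formula L [::] := if n is n'.+1 then Imp Bot (F n') else Bot.
apply: (@rel_card_le _ _ _ _ (fun n (f : {G & @formula L G}) => f = existT _ [::] (F n))).
  by move=> n _; exists (existT _ [::] (F n)).
pose depth := fix depth G (f : @formula L G) : nat := match f with
  | Imp _ g => (depth G g).+1 | _ => 0%N end.
have dF n : depth _ (F n) = n by elim: n => //= n ->.
move=> n m f _ _ _ -> /(congr1 (fun f : {G & @formula L G} => depth _ (projT2 f))) /=.
by rewrite !dF.
Qed.

Lemma type_definable_closed L (N : structure L) K G (X : set (tup N G)) :
  type_definable K X -> exists2 A, card_lt A K & forall B, A `<=` B -> closed B X.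
Proof.
move=> [A [p [Alt pA ->]]]; exists A => // B AB a.
move=> /existsNP[phi /not_implyP[pphi nphi]]; exists (psat phi); split=> //.
  by exists phi => //; exact: subset_trans (pA _ pphi) AB.
by move=> x; apply.
Qed.

Lemma uniform_ucorr L (N : structure L) K (A : set {s & N s}) G D
    (X : set (tup N G)) (Y : set (tup N D)) C k l :
  closed A C -> uniform_correspondence K X Y C k l -> ucorr A X Y C k l.
Proof.
move=> Cc [[_ [w Cw] Csub _ _] Cr Cl].
have [x [y e]] := tcatP w; rewrite {}e in Cw.
have eqr u : X u -> rfibre Y C u = [set v | C (tcat u v)].
  by move=> Xu; apply/seteqP; split=> v /=; [case|move=> h; split=> //; have [] := Csub _ _ h].
have eql v : Y v -> lfibre X C v = [set u | C (tcat u v)].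
  by move=> Xu; apply/seteqP; split=> u /=; [case|move=> h; split=> //; have [] := Csub _ _ h].
have Cr' u : X u -> finite_set [set v | C (tcat u v)] /\ ncard [set v | C (tcat u v)] = k.
  move=> Xu; have := Cr _ Xu; rewrite eqr// => h.
  by split; [exists k|exact: card_ncard].
have Cl' v : Y v -> finite_set [set u | C (tcat u v)] /\ ncard [set u | C (tcat u v)] = l.
  move=> Yv; have := Cl _ Yv; rewrite eql// => h.
  by split; [exists l|exact: card_ncard].
have [Xx Yy] := Csub _ _ Cw.
split=> //.
  by have [fin <-] := Cr' _ Xx; apply: ncard_gt0 => //; exists y.
by have [fin <-] := Cl' _ Yy; apply: ncard_gt0 => //; exists x.
Qed.

Theorem theorem2p12 (L : language) (T : theory L) (K : Type) (U : structure L)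
    (hT : complete T) (hstable : omega_stable T) (hU : monster T K U)
    (hunimod : unimodular K U) :
  corr_unimodular K U.
Proof.
move=> G D X Y C1 C2 k1 l1 k2 l2 Xd Yd C1u C2u.
have [UT Ularge Usat _] := hU.
have Kunc := uncountable_of_formulas U Ularge.
have Ncpt := eq_kcompact Kunc (saturated_kcompact Usat).
have [A1 A1lt C1c] := type_definable_closed (corr_def (ucorr_corr C1u)).
have [A2 A2lt C2c] := type_definable_closed (corr_def (ucorr_corr C2u)).
have [A3 A3lt Xc] := type_definable_closed Xd.
(* A single small set over which [X] and both correspondences are type-definable; all types are
   taken over it. *)
pose A := A1 `|` A2 `|` A3.
have Alt : card_lt A K by apply: card_ltU => //; exact: card_ltU.
have R1u : ucorr A X Y C1 k1 l1.
  by apply: uniform_ucorr C1u; apply: C1c => x ?; left; left.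
have R2u : ucorr A X Y C2 k2 l2.
  by apply: uniform_ucorr C2u; apply: C2c => x ?; left; right.
have Xn : X !=set0.
  have [w Cw] := corr_nonempty (ucorr_corr C1u); have [x [y e]] := tcatP w.
  by exists x; rewrite e in Cw; have [] := ucorr_sub R1u Cw.
apply: (ucorr_unique Kunc Ncpt Alt) R1u R2u => //.
- move=> P a b ab [algab algba]; rewrite -!mult_deg.
  apply: esym; apply: hunimod => //; first exact/tp_eqP.
  by split; [exact: (alg_acl Kunc Ncpt Alt algba)|exact: (alg_acl Kunc Ncpt Alt algab)].
- apply: eq_no_tree => P; exact: omega_stable_no_tree hstable UT.
- by apply: Xc => x ?; right.
Qed.
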